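(* For every $t\ge 0$, $$N_{\mathrm{KB}}(t) = \tfrac{1}{2} N_{T_{1,2}}(t) \pm \tfrac{1}{2},$$ that is, $N_{\mathrm{KB}}(t) - \frac12 N_{T_{1,2}}(t) \in \{-\frac12, \frac12\}$.
   Context: The standard flat Klein bottle KB is obtained from the square $[0,1]\times[0,1]$ by identifying the vertical boundary edges directly and the horizontal boundary edges with reflection. Functions on KB correspond to functions $u$ on $\mathbb{R}^2$ satisfying $u(x+1,y)=u(x,y)$ and $u(1-x,y+1)=u(x,y)$ for all $x,y$. The Laplacian on KB is the standard Laplacian $-\left(\partial_x^2+\partial_y^2\right)$ (sign chosen so that eigenvalues are nonnegative) acting on such smooth functions. $N_{\mathrm{KB}}(t)$ is its eigenvalue counting function: the number of eigenvalues $\le t$, counted with multiplicity. $N_{T_{1,2}}(t)$ is the eigenvalue counting function (with multiplicity) of the Laplacian on the flat torus $T_{1,2}=[0,1]\times[0,2]$ with opposite sides identified directly, i.e. on functions on $\mathbb{R}^2$ with period $1$ in $x$ and period $2$ in $y$; explicitly, $N_{T_{1,2}}(t)=\#\{(j,k)\in\mathbb{Z}^2 : (2\pi)^2(j^2+(k/2)^2)\le t\}$. *)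

(* Defs.v *)
From HB Require Import structures.
From mathcomp Require Import all_boot all_order all_algebra.
From mathcomp Require Import all_classical all_reals all_analysis.

Set Implicit Arguments.
Unset Strict Implicit.
Unset Printing Implicit Defensive.

Import Order.TTheory GRing.Theory Num.Theory.
Import numFieldNormedType.Exports.

Local Open Scope classical_set_scope.
Local Open Scope ring_scope.

Definition pd1 (R : realType) (u : R * R -> R) : R * R -> R :=
  fun p => 'D_((1, 0) : R * R) u p.

Definition pd2 (R : realType) (u : R * R -> R) : R * R -> R :=
  fun p => 'D_((0, 1) : R * R) u p.

Fixpoint is_Ck (R : realType) (k : nat) (u : R * R -> R) : Prop :=
  continuous u /\
  if k is k'.+1 then
    [/\ forall p : R * R, derivable u p ((1, 0) : R * R),
        forall p : R * R, derivable u p ((0, 1) : R * R),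
        is_Ck k' (pd1 u) & is_Ck k' (pd2 u)]
  else True.

Definition smooth (R : realType) (u : R * R -> R) : Prop :=
  forall k : nat, is_Ck k u.

(* The sign makes the Laplacian a nonnegative operator. *)
Definition laplacian (R : realType) (u : R * R -> R) : R * R -> R :=
  fun p => - (pd1 (pd1 u) p + pd2 (pd2 u) p).

(* A function on the quotient surface is a smooth function on the plane with
   the matching invariance; real-valued functions are used, the Laplacian being
   a real operator whose eigenvalues are all real. *)
Definition KB_functions (R : realType) : set (R * R -> R) :=
  [set u | [/\ smooth u,
               forall x y : R, u (x + 1, y) = u (x, y) &
               forall x y : R, u (1 - x, y + 1) = u (x, y)]].

Definition T12_functions (R : realType) : set (R * R -> R) :=
  [set u | [/\ smooth u,
               forall x y : R, u (x + 1, y) = u (x, y) &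
               forall x y : R, u (x, y + 2) = u (x, y)]].

Arguments KB_functions R : clear implicits.
Arguments T12_functions R : clear implicits.

Definition lap_eigenspace (R : realType) (X : set (R * R -> R)) (lam : R) :
    set (R * R -> R) :=
  [set u | X u /\ forall p : R * R, laplacian u p = lam * u p].

Definition is_eigenvalue (R : realType) (X : set (R * R -> R)) (lam : R) : Prop :=
  exists u : R * R -> R, lap_eigenspace X lam u /\ exists p : R * R, u p <> 0.

Definition lin_indep (R : realType) (n : nat) (f : 'I_n -> (R * R -> R)) : Prop :=
  forall c : 'I_n -> R,
    (forall p : R * R, \sum_(i < n) c i * f i p = 0) -> forall i, c i = 0.

(* Dimension of a linear subspace V, possibly +oo. *)
Definition lin_dim (R : realType) (V : set (R * R -> R)) : \bar R :=
  ereal_sup [set (n%:R : R)%:E | n in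
    [set n : nat | exists f : 'I_n -> (R * R -> R),
                     (forall i, V (f i)) /\ lin_indep f]].

Definition counting (R : realType) (X : set (R * R -> R)) (t : R) : \bar R :=
  \esum_(lam in [set lam : R | is_eigenvalue X lam /\ lam <= t])
    lin_dim (lap_eigenspace X lam).

Definition N_KB (R : realType) (t : R) : \bar R := counting (KB_functions R) t.

Definition N_T12 (R : realType) (t : R) : \bar R := counting (T12_functions R) t.

(* Main.v *)
Require Import Defs.
From HB Require Import structures.
From mathcomp Require Import all_boot all_order all_algebra.
From mathcomp Require Import all_classical all_reals all_analysis.
From mathcomp Require Import complex spectral ring lra zify.
Import Order.TTheory GRing.Theory Num.Theory.
Import numFieldNormedType.Exports.
Local Open Scope ring_scope.

(** Let lam be an eigenvalue of the torus of sides 1 and 2, and let g be the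
    glide reflection (x, y) -> (1 - x, y + 1). Composition with g is an
    involution of the eigenspace, whose symmetric part is the eigenspace of the
    Klein bottle; let the other part, where u o g = - u, be called
    antisymmetric. Since g reverses x, the derivative d/dx exchanges the two
    parts, and d^2u/dx^2 = 0 forces du/dx = 0 for a function periodic in x, so
    the image of d/dx meets its kernel in 0. By linear algebra ([index_zero])
    d/dx then has the same rank on the two parts: the difference of
    dimensions, symmetric minus antisymmetric, is the same as for the kernels
    of d/dx, i.e. for the eigenfunctions that depend on y alone
    ([eigenspace_dims]). These are the constants (symmetric) and, for every
    k >= 1, the span of cos (k pi y) and sin (k pi y), with eigenvalue
    (k pi)^2, symmetric for k even and antisymmetric for k odd ([ker_dim]). If
    M is the largest k with (k pi)^2 <= t, the total of the differences over
    the eigenvalues up to t is 1 + sum_(1 <= k <= M) 2 (-1)^k = (-1)^M. As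
    N_T12 is the sum of the symmetric and antisymmetric dimensions and N_KB is
    the sum of the symmetric ones, 2 N_KB - N_T12 = 1 or -1.

    For this to make sense everything has to be finite. No Fourier expansion
    or integration is involved. Eigenspaces are finite-dimensional because an
    eigenfunction has gradient bounded by a constant times its supremum (the
    maximum principle for |grad u|^2 + a u^2, [bernstein]), so that it is 0 as
    soon as it vanishes on a fine enough grid ([torus_points]). On a
    finite-dimensional space d/dx has a complex eigenvector; periodicity makes
    its eigenvalue imaginary, and the same for d/dy on the subspace obtained
    gives a nonzero eigenfunction with v_xx = - b^2 v and v_yy = - c^2 v. The
    periods 1 and 2 quantize b and c ([eigenvalue_form]), so there are finitely
    many eigenvalues up to t. *)

(** * One-variable calculus and symmetry of second derivatives *)

Section OneVariable.
Set Implicit Arguments.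
Unset Strict Implicit.
Local Open Scope classical_set_scope.
Local Open Scope ring_scope.
Variable R : realType.
Implicit Types f df : R -> R.

Lemma mean_value f df (a b : R) : a < b -> (forall x : R, is_derive x 1 f (df x)) ->
  exists c, [/\ a < c, c < b & f b - f a = df c * (b - a)].
Proof.
move=> ab dfE; have cf : {within `[a, b], continuous f}.
  apply: continuous_subspaceT => x; apply: differentiable_continuous.
  by apply/derivable1_diffP; exact: ex_derive.
have [c] := MVT ab (fun x _ => dfE x) cf.
by rewrite in_itv /= => /andP[ac cb] E; exists c.
Qed.

(** The second-order condition: were the second derivative positive, the first
    one would be positive just to the right of the maximum, and the function
    would increase there. *)
Lemma derive_at_max f df (d x0 : R) : (forall x : R, is_derive x 1 f (df x)) ->
  is_derive x0 1 df d -> (forall x, f x <= f x0) -> df x0 = 0 /\ d <= 0.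
Proof.
move=> dfE ddf fmax.
have df0 : df x0 = 0.
  have dc : is_derive x0 1 f 0.
    apply: (@derive1_at_max _ _ (x0 - 1) (x0 + 1)).
    - by move: (x0) => z; lra.
    - by move=> y _; exact: ex_derive.
    - by rewrite in_itv /=; apply/andP; split; lra.
    - by move=> y _; exact: fmax.
  by rewrite -(@derive_val _ _ _ _ _ _ _ dc) (@derive_val _ _ _ _ _ _ _ (dfE x0)).
split=> //; rewrite leNgt; apply/negP => d0.
have [cdf dfd] := ddf.
have : h^-1 *: ((df \o shift x0) (h *: 1) - df x0) @[h --> 0^'] --> d.
  by rewrite -dfd; exact: cdf.
move=> /cvgrPdist_lt /(_ d d0); rewrite near_withinE => -[e /= e0 He].
have df_pos h : 0 < h -> h < e -> 0 < df (x0 + h).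
  move=> h0 he; have := He h; rewrite /= sub0r normrN gtr0_norm // => /(_ he (lt0r_neq0 h0)).
  rewrite df0 subr0 [_%:A]mulr1 /= (addrC h) ltr_norml => /andP[_ H].
  have : 0 < h^-1 * df (x0 + h) by move: H; rewrite ltrBlDr ltrDl.
  by rewrite pmulr_rgt0 // invr_gt0.
have he2 : x0 < x0 + e / 2 by lra.
have [c [xc cx E]] := mean_value he2 dfE.
have := fmax (x0 + e / 2); rewrite leNgt => /negP; apply.
rewrite -subr_gt0 E; apply: mulr_gt0; last by lra.
by rewrite (_ : c = x0 + (c - x0)); [apply: df_pos; lra | ring].
Qed.

End OneVariable.

Section Partials.
Set Implicit Arguments.
Unset Strict Implicit.
Local Open Scope classical_set_scope.
Local Open Scope ring_scope.
Variable R : realType.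
Implicit Types u v : R * R -> R.

(** Partial derivatives are handled as one-variable derivatives along
    horizontal and vertical lines. *)
Lemma line1 u (x y d : R) : is_derive ((x, y) : R * R) ((1, 0) : R * R) u d <->
  is_derive x 1 (fun s => u (s, y)) d.
Proof.
have E : (fun h : R => h^-1 *:
      ((u \o shift ((x, y) : R * R)) (h *: ((1, 0) : R * R)) - u (x, y)))
  = (fun h => h^-1 *: (((fun s => u (s, y)) \o shift x) (h *: 1) - u (x, y))).
  apply/funext => h; rewrite /= ; congr (_ *: (u _ - _)).
  by rewrite /GRing.add /= /add_pair /= /GRing.scale /= ; congr pair; rewrite mulr0 add0r.
by split=> -[H1 H2]; constructor; move: H1 H2; rewrite /derivable /derive E.
Qed.

Lemma line2 u (x y d : R) : is_derive ((x, y) : R * R) ((0, 1) : R * R) u d <->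
  is_derive y 1 (fun s => u (x, s)) d.
Proof.
have E : (fun h : R => h^-1 *:
      ((u \o shift ((x, y) : R * R)) (h *: ((0, 1) : R * R)) - u (x, y)))
  = (fun h => h^-1 *: (((fun s => u (x, s)) \o shift y) (h *: 1) - u (x, y))).
  apply/funext => h; rewrite /= ; congr (_ *: (u _ - _)).
  by rewrite /GRing.add /= /add_pair /= /GRing.scale /= ; congr pair; rewrite mulr0 add0r.
by split=> -[H1 H2]; constructor; move: H1 H2; rewrite /derivable /derive E.
Qed.

Lemma smooth_continuous u : smooth u -> continuous u.
Proof. by move=> /(_ 0%N)[]. Qed.

Lemma smooth_pd1 u : smooth u -> smooth (pd1 u).
Proof. by move=> su k; have [_ []] := su k.+1. Qed.

Lemma smooth_pd2 u : smooth u -> smooth (pd2 u).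
Proof. by move=> su k; have [_ []] := su k.+1. Qed.

Lemma pd1P u (x y : R) : smooth u -> is_derive x 1 (fun s => u (s, y)) (pd1 u (x, y)).
Proof. by move=> /(_ 1%N)[_ [D _ _ _]]; apply/line1/derivableP. Qed.

Lemma pd2P u (x y : R) : smooth u -> is_derive y 1 (fun s => u (x, s)) (pd2 u (x, y)).
Proof. by move=> /(_ 1%N)[_ [_ D _ _]]; apply/line2/derivableP. Qed.

Lemma pd1E u (x y d : R) : is_derive x 1 (fun s => u (s, y)) d -> pd1 u (x, y) = d.
Proof. by move=> /line1 D; exact: derive_val. Qed.

Lemma pd2E u (x y d : R) : is_derive y 1 (fun s => u (x, s)) d -> pd2 u (x, y) = d.
Proof. by move=> /line2 D; exact: derive_val. Qed.

(** Over a small square with corner (x, y), the second difference of u equals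
    the area times a value of u12 and also times a value of u21, by the mean
    value theorem used twice in either order. *)
Lemma mixed_partials_eq u u1 u2 u12 u21 (x y : R) :
  (forall s t : R, is_derive s 1 (fun r => u (r, t)) (u1 (s, t))) ->
  (forall s t : R, is_derive t 1 (fun r => u (s, r)) (u2 (s, t))) ->
  (forall s t : R, is_derive t 1 (fun r => u1 (s, r)) (u12 (s, t))) ->
  (forall s t : R, is_derive s 1 (fun r => u2 (r, t)) (u21 (s, t))) ->
  continuous u12 -> continuous u21 -> u21 (x, y) = u12 (x, y).
Proof.
move=> d1 d2 d12 d21 c12 c21; apply/eqP; rewrite eq_sym -subr_eq0.
apply/negPn/negP => AB.
have AB0 : 0 < `|u12 (x, y) - u21 (x, y)| / 2 by rewrite divr_gt0 // normr_gt0.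
have near_pt (w : R * R -> R) : continuous w -> exists2 e : R, 0 < e &
    forall s t, x < s < x + e -> y < t < y + e ->
      `|w (x, y) - w (s, t)| < `|u12 (x, y) - u21 (x, y)| / 2.
  move=> cw; have /cvgrPdist_lt /(_ _ AB0) /nbhs_ballP [e e0 He] := cw (x, y).
  exists e => // s t /andP[s1 s2] /andP[t1 t2]; apply: He; split => /=;
    rewrite /ball /= distrC ger0_norm; lra.
have [e1 e10 H1] := near_pt _ c12; have [e2 e20 H2] := near_pt _ c21.
pose e := Num.min e1 e2 / 2.
have [e0 ee1 ee2] : [/\ 0 < e, e < e1 & e < e2].
  have m0 : 0 < Num.min e1 e2 by rewrite lt_min e10 e20.
  have [m1 m2] : Num.min e1 e2 <= e1 /\ Num.min e1 e2 <= e2.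
    by split; rewrite ge_min lexx ?orbT.
  by rewrite /e; split; lra.
have xe : x < x + e by lra.
have ye : y < y + e by lra.
have D1 : forall s : R, is_derive s 1 (fun s => u (s, y + e) - u (s, y))
    (u1 (s, y + e) - u1 (s, y)).
  by move=> s; apply: is_deriveB; exact: d1.
have D2 : forall t : R, is_derive t 1 (fun t => u (x + e, t) - u (x, t))
    (u2 (x + e, t) - u2 (x, t)).
  by move=> t; apply: is_deriveB; exact: d2.
have [s [s1 s2 Es]] := mean_value xe D1.
have [t [t1 t2 Et]] := mean_value ye D2.
have [t' [t'1 t'2 Et']] := mean_value ye (d12 s).
have [s' [s'1 s'2 Es']] := mean_value xe (d21 ^~ t).
have E : u12 (s, t') = u21 (s', t).
  have ee : e * e != 0 by rewrite mulf_neq0 // lt0r_neq0.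
  rewrite Et' in Es; rewrite Es' in Et; apply: (mulIf ee).
  have -> : u12 (s, t') * (e * e) = u12 (s, t') * (y + e - y) * (x + e - x) by ring.
  have -> : u21 (s', t) * (e * e) = u21 (s', t) * (x + e - x) * (y + e - y) by ring.
  by rewrite -Es -Et; ring.
have H3 : `|u12 (x, y) - u12 (s, t')| < `|u12 (x, y) - u21 (x, y)| / 2.
  by apply: H1; lra.
have H4 : `|u21 (x, y) - u21 (s', t)| < `|u12 (x, y) - u21 (x, y)| / 2.
  by apply: H2; lra.
rewrite E in H3.
have := ler_distD (u21 (s', t)) (u12 (x, y)) (u21 (x, y)).
by rewrite leNgt => /negP; apply; rewrite (distrC _ (u21 (x, y))); lra.
Qed.

Lemma pd_commute u : smooth u -> pd1 (pd2 u) = pd2 (pd1 u).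
Proof.
move=> su; have s1 := smooth_pd1 su; have s2 := smooth_pd2 su.
apply/funext => -[x y]; apply: (@mixed_partials_eq u (pd1 u) (pd2 u)).
- by move=> s t; exact: pd1P.
- by move=> s t; exact: pd2P.
- by move=> s t; exact: pd2P.
- by move=> s t; exact: pd1P.
- exact: smooth_continuous (smooth_pd2 s1).
- exact: smooth_continuous (smooth_pd1 s2).
Qed.

End Partials.

(** * Finite-dimensional spaces of functions *)

Section LinearAlgebra.
Set Implicit Arguments.
Unset Strict Implicit.
Local Open Scope classical_set_scope.
Local Open Scope ring_scope.
Variable R : realType.
Local Notation fn := (R * R -> R).
Implicit Types (u v : fn) (S K A E : set fn).

Definition comb n (c : 'I_n -> R) (f : 'I_n -> fn) : fn :=
  fun p => \sum_(i < n) c i * f i p.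

Definition subspace S : Prop := S (fun=> 0) /\
  forall (a b : R) u v, S u -> S v -> S (fun p => a * u p + b * v p).

Definition linear_on E (D : fn -> fn) : Prop := forall (a b : R) u v, E u -> E v ->
  D (fun p => a * u p + b * v p) = (fun p => a * D u p + b * D v p).

(** A relation rather than a number, so that spaces which are not yet known to
    be finite-dimensional need no junk value. *)
Definition has_dim S n : Prop := exists f : 'I_n -> fn,
  [/\ forall i, S (f i), lin_indep f & forall u, S u -> exists c, u = comb c f].

Lemma subspace_comb S n (c : 'I_n -> R) (f : 'I_n -> fn) :
  subspace S -> (forall i, S (f i)) -> S (comb c f).
Proof.
move=> [S0 SD]; elim: n c f => [|n IH] c f Sf.
  by rewrite /comb (_ : (fun p => _) = fun=> 0) //; apply/funext=> p; rewrite big_ord0.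
pose w i : 'I_n.+1 := widen_ord (leqnSn n) i.
have := SD 1 (c ord_max) _ _ (IH (c \o w) _ (fun i => Sf (w i))) (Sf ord_max).
by congr S; apply/funext => p; rewrite /comb big_ord_recr /= mul1r.
Qed.

Lemma linear_on_comb E D n (c : 'I_n -> R) (f : 'I_n -> fn) :
  subspace E -> linear_on E D -> (forall i, E (f i)) ->
  D (comb c f) = comb c (fun i => D (f i)).
Proof.
move=> sE lD; elim: n c f => [|n IH] c f Ef.
  have := lD 0 0 _ _ sE.1 sE.1.
  rewrite (_ : (fun p => _) = comb c f); last first.
    by apply/funext => p; rewrite /comb big_ord0 !mul0r addr0.
  by move=> ->; apply/funext => p; rewrite /comb big_ord0 !mul0r addr0.
pose w i : 'I_n.+1 := widen_ord (leqnSn n) i.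
have split_comb (g : 'I_n.+1 -> fn) :
    comb c g = fun p => 1 * comb (c \o w) (g \o w) p + c ord_max * g ord_max p.
  by apply/funext => p; rewrite /comb big_ord_recr mul1r.
rewrite [LHS](congr1 D (split_comb f)) lD //; last by apply: subspace_comb => // i; exact: Ef.
by rewrite split_comb IH // => i; exact: Ef.
Qed.

(** Families of combinations of f are encoded by matrices, composition being
    matrix product; rank computations on maps between spaces of functions
    become rank computations on matrices. *)
Lemma comb_comb m n (x : 'I_m -> R) (C : 'M[R]_(m, n)) (f : 'I_n -> fn) :
  comb x (fun i => comb (C i) f) = comb (((\row_i x i) *m C) ord0) f.
Proof.
apply/funext => p; rewrite /comb.
under eq_bigr => i _ do rewrite mulr_sumr.
rewrite exchange_big /=; apply: eq_bigr => j _; rewrite mxE mulr_suml.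
by apply: eq_bigr => i _; rewrite mxE mulrA.
Qed.

Lemma comb0 n (f : 'I_n -> fn) : comb (fun=> 0) f = fun=> 0.
Proof. by apply/funext => p; rewrite /comb big1 // => i _; rewrite mul0r. Qed.

Lemma lin_indepP n (f : 'I_n -> fn) : lin_indep f <->
  forall x : 'rV[R]_n, comb (x ord0) f = (fun=> 0) -> x = 0.
Proof.
split=> [li x E|li c c0 i].
  by apply/rowP => i; rewrite mxE; apply: li => p; exact: (congr1 (fun g => g p) E).
have /rowP/(_ i) : \row_i c i = 0; last by rewrite !mxE.
apply: li; apply/funext => p; rewrite -[RHS](c0 p); apply: eq_bigr => j _.
by rewrite mxE.
Qed.

Lemma row_free_size m n (C : 'M[R]_(m, n)) :
  (forall x : 'rV[R]_m, x *m C = 0 -> x = 0) -> (m <= n)%N.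
Proof.
move=> inj; have fC : row_free C.
  by rewrite -kermx_eq0; apply/rowV0P => v /sub_kermxP; exact: inj.
by rewrite -(eqP fC) rank_leq_col.
Qed.

Lemma lin_indep_comb m n (C : 'M[R]_(m, n)) (f : 'I_n -> fn) : lin_indep f ->
  lin_indep (fun i => comb (C i) f) <-> (forall x : 'rV[R]_m, x *m C = 0 -> x = 0).
Proof.
move=> /lin_indepP fi; split=> [/lin_indepP li x xC|inj].
  apply: li; rewrite comb_comb (_ : \row_i _ = x) ?xC; last first.
    by apply/rowP => i; rewrite mxE.
  by rewrite -(comb0 f); congr comb; apply/funext=> i; rewrite mxE.
apply/lin_indepP => x; rewrite comb_comb (_ : \row_i _ = x); last first.
  by apply/rowP => i; rewrite mxE.
by move=> /fi /inj.
Qed.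

Lemma span_matrix S m n (g : 'I_m -> fn) (f : 'I_n -> fn) :
  (forall u, S u -> exists c, u = comb c f) -> (forall i, S (g i)) ->
  exists C : 'M[R]_(m, n), g = fun i => comb (C i) f.
Proof.
move=> span Sg; have [c cE] := choice (fun i => span _ (Sg i)).
exists (\matrix_(i, j) c i j); apply/funext => i; rewrite [LHS]cE.
by congr comb; apply/funext => j; rewrite mxE.
Qed.

Lemma has_dim_lin_dim S n : has_dim S n -> lin_dim S = (n%:R)%:E.
Proof.
move=> [f [Sf fi span]]; apply/eqP; rewrite eq_le; apply/andP; split.
  apply: ge_ereal_sup => _ [m [g [Sg gi]] <-]; rewrite lee_fin ler_nat.
  have [C gC] := span_matrix span Sg; rewrite gC in gi.
  by apply: (row_free_size (C := C)); apply/(lin_indep_comb C fi).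
by apply: ereal_sup_ubound; exists n => //; exists f.
Qed.

(** If evaluation at N points is injective on S, independent families have at
    most N members, and one of maximal size spans. *)
Lemma has_dim_points S N (p : 'I_N -> R * R) : subspace S ->
  (forall u, S u -> (forall j, u (p j) = 0) -> u = fun=> 0) ->
  exists n, has_dim S n.
Proof.
move=> sS inj.
pose P n := exists f : 'I_n -> fn, (forall i, S (f i)) /\ lin_indep f.
have P0 : exists n, `[<P n>].
  exists 0%N; apply/asboolP; exists (fun i _ => 0); split; first by case.
  by move=> c _ [].
have Ple n : `[<P n>] -> (n <= N)%N.
  move=> /asboolP[f [Sf /lin_indepP fi]].
  apply: (@row_free_size _ _ (\matrix_(i, j) f i (p j))) => x x0; apply: fi.
  apply: inj; first exact: subspace_comb.
  move=> j; have /rowP/(_ j) := x0; rewrite !mxE => <-.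
  by apply: eq_bigr => i _; rewrite mxE.
have [n /asboolP[f [Sf fi]] nmax] := ex_maxnP P0 Ple.
exists n, f; split=> // u Su.
pose g (i : 'I_n.+1) := if unlift ord_max i is Some j then f j else u.
have Sg i : S (g i) by rewrite /g; case: unlift.
have : ~ lin_indep g.
  by move=> gi; have /nmax : `[<P n.+1>] by [apply/asboolP; exists g]; rewrite ltnn.
move=> /existsNP[c /not_implyP[c0 /existsNP[i ci]]].
have sumE q : c ord_max * u q + comb (fun j => c (lift ord_max j)) f q = 0.
  rewrite -[RHS](c0 q) (bigD1_ord ord_max) //= /g unlift_none; congr (_ + _).
  by apply: eq_bigr => j _; rewrite liftK.
have cu : c ord_max != 0.
  apply/eqP => cm0; apply: ci; have cl : forall j, c (lift ord_max j) = 0.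
    by apply: fi => q; have := sumE q; rewrite cm0 mul0r add0r.
  by case: (unliftP ord_max i) => [j|] ->.
exists (fun j => - (c ord_max)^-1 * c (lift ord_max j)); apply/funext => q.
rewrite /comb; under eq_bigr => j _ do rewrite -mulrA.
rewrite -mulr_sumr (_ : \sum_(j < n) _ = - (c ord_max * u q)).
  by rewrite mulrNN mulKf.
by apply/eqP; rewrite -addr_eq0 addrC; apply/eqP; exact: sumE.
Qed.

Lemma has_dim_direct_sum S K A m n : K `<=` S -> A `<=` S ->
  (forall u v, K u -> A v -> (fun p => u p + v p) = (fun=> 0) -> u = (fun=> 0) /\ v = fun=> 0) ->
  (forall w, S w -> exists u v, [/\ K u, A v & w = fun p => u p + v p]) ->
  subspace K -> subspace A ->
  has_dim K m -> has_dim A n -> has_dim S (m + n).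
Proof.
move=> KS AS disj dec sK sA [f [Kf fi fs]] [g [Ag gi gs]].
pose h (i : 'I_(m + n)) := match fintype.split i with inl j => f j | inr k => g k end.
have hE c : comb c h = fun p => comb (c \o @lshift m n) f p + comb (c \o @rshift m n) g p.
  apply/funext => p; rewrite /comb big_split_ord /=; congr (_ + _).
    by apply: eq_bigr => i _; rewrite /h (unsplitK (inl i)).
  by apply: eq_bigr => i _; rewrite /h (unsplitK (inr i)).
exists h; split.
- by move=> i; rewrite /h; case: fintype.split => j; [exact/KS/Kf|exact/AS/Ag].
- move=> c c0; have := funext c0; rewrite -/(comb c h) hE.
  move=> /(disj _ _ (subspace_comb _ sK Kf) (subspace_comb _ sA Ag))[c1 c2] i.
  rewrite -(splitK i); case: fintype.split => j /=.
    by apply: (fi (c \o @lshift m n)) => p; have := congr1 (fun F => F p) c1.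
  by apply: (gi (c \o @rshift m n)) => p; have := congr1 (fun F => F p) c2.
- move=> w /dec[u [v [/fs[c1 ->] /gs[c2 ->] ->]]].
  exists (fun i => match fintype.split i with inl j => c1 j | inr k => c2 k end).
  rewrite hE; apply/funext => p; congr (_ + _); apply: eq_bigr => i _ /=; congr (_ * _).
    by rewrite (unsplitK (inl i)).
  by rewrite (unsplitK (inr i)).
Qed.

Lemma comb_matrix_inj m n (x : 'rV[R]_m) (P : 'M[R]_(m, n)) (g : 'I_n -> fn) :
  lin_indep g -> comb (x ord0) (fun i => comb (P i) g) = (fun=> 0) <-> x *m P = 0.
Proof.
have -> : comb (x ord0) (fun i => comb (P i) g) = comb ((x *m P) ord0) g.
  by rewrite comb_comb; congr (comb ((_ *m _) _)); apply/rowP => i; rewrite mxE.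
move=> /lin_indepP gi; split=> [/gi //|->].
by rewrite -(comb0 g); congr comb; apply/funext => i; rewrite mxE.
Qed.

(** In coordinates the kernel of D is the row kernel of the matrix P of D. *)
Lemma has_dim_ker E K D m n (f : 'I_m -> fn) (g : 'I_n -> fn) (P : 'M[R]_(m, n)) :
  subspace E -> linear_on E D -> K `<=` E -> subspace K ->
  (forall i, K (f i)) -> lin_indep f -> (forall u, K u -> exists c, u = comb c f) ->
  lin_indep g -> (fun i => D (f i)) = (fun i => comb (P i) g) ->
  has_dim [set u | K u /\ D u = fun=> 0] (m - \rank P).
Proof.
move=> sE lD KE sK Kf fi fs gi DP.
have DcombE x : D (comb x f) = comb x (fun i => comb (P i) g).
  by rewrite -DP; exact: (linear_on_comb _ sE lD (fun i => KE _ (Kf i))).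
rewrite -mxrank_ker; pose B := row_base (kermx P).
exists (fun i => comb (B i) f); split.
- move=> i; split; first exact: (subspace_comb _ sK Kf).
  rewrite DcombE; have -> : B i = row i B ord0 by apply/funext => j; rewrite [RHS]mxE.
  apply/(comb_matrix_inj _ _ gi)/sub_kermxP.
  by apply: (submx_trans (row_sub _ _)); rewrite eq_row_base.
- apply/(lin_indep_comb B fi) => x xB.
  apply/eqP; rewrite -(mulmx_free_eq0 x (row_base_free (kermx P))); exact/eqP.
- move=> u [Ku Du]; have [c uE] := fs u Ku.
  pose x : 'rV[R]_m := \row_i c i.
  have cx : c = x ord0 by apply/funext => i; rewrite mxE.
  have : (x <= B)%MS.
    rewrite eq_row_base; apply/sub_kermxP/(comb_matrix_inj _ _ gi).
    by rewrite -cx -DcombE -uE.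
  move=> /submxP[y xy]; exists (y ord0).
  rewrite uE cx xy comb_comb; congr (comb ((_ *m _) _)).
  by apply/rowP => i; rewrite mxE.
Qed.

(** The hypothesis on D o D says that D is injective on its image, so the rank
    of D from K to A is at most its rank from A to K, and conversely. The two
    ranks agree, and the dimension identity is rank-nullity on either side. *)
Lemma index_zero E K A D m n : subspace E -> linear_on E D ->
  K `<=` E -> A `<=` E -> subspace K -> subspace A ->
  (forall u, K u -> A (D u)) -> (forall u, A u -> K (D u)) ->
  (forall u, E u -> D (D u) = (fun=> 0) -> D u = fun=> 0) ->
  has_dim K m -> has_dim A n ->
  exists k l, [/\ has_dim [set u | K u /\ D u = fun=> 0] k,
    has_dim [set u | A u /\ D u = fun=> 0] l & (m + l = n + k)%N].
Proof.
move=> sE lD KE AE sK sA DKA DAK D2 [f [Kf fi fs]] [g [Ag gi gs]].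
have [P PE] := span_matrix gs (fun i => DKA _ (Kf i)).
have [Q QE] := span_matrix fs (fun i => DAK _ (Ag i)).
exists (m - \rank P)%N, (n - \rank Q)%N; split.
- exact: (has_dim_ker sE lD KE sK Kf fi fs gi PE).
- exact: (has_dim_ker sE lD AE sA Ag gi gs fi QE).
suff -> : \rank P = \rank Q.
  have := rank_leq_col P; have := rank_leq_row P; have := rank_leq_row Q.
  have := rank_leq_col Q; lia.
have rank_le a b (s : 'I_a -> fn) (t : 'I_b -> fn) (U : 'M[R]_(a, b)) (W : 'M[R]_(b, a)) :
    (forall i, E (s i)) -> (forall i, E (t i)) -> lin_indep s -> lin_indep t ->
    (fun i => D (s i)) = (fun i => comb (U i) t) ->
    (fun i => D (t i)) = (fun i => comb (W i) s) -> (\rank U <= \rank W)%N.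
  move=> Es Et si ti UE WE.
  have ker0 (x : 'rV[R]_a) : x *m (U *m W) = 0 -> x *m U = 0.
    rewrite mulmxA => xUW.
    have Dx : D (comb (x ord0) s) = comb ((x *m U) ord0) t.
      rewrite (linear_on_comb _ sE lD Es) UE comb_comb.
      by congr (comb ((_ *m _) _)); apply/rowP => i; rewrite mxE.
    have /D2 : E (comb (x ord0) s) by exact: subspace_comb.
    rewrite Dx (linear_on_comb _ sE lD Et) WE => D0.
    by have /lin_indepP/(_ _ (D0 _)) := ti; apply; apply/(comb_matrix_inj _ _ si).
  have : (kermx (U *m W) <= kermx U)%MS.
    apply/sub_kermxP/row_matrixP => i; rewrite row_mul row0; apply: ker0.
    by rewrite -row_mul mulmx_ker row0.
  move=> /mxrankS; rewrite !mxrank_ker.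
  rewrite leq_sub2lE ?rank_leq_row // => UW.
  exact: (leq_trans UW (mxrankM_maxr U W)).
apply/eqP; rewrite eqn_leq; apply/andP; split.
  by apply: (rank_le m n f g) => // i; [exact/KE/Kf|exact/AE/Ag].
by apply: (rank_le n m g f) => // i; [exact/AE/Ag|exact/KE/Kf].
Qed.

(** Real and imaginary parts of an eigenvector, with eigenvalue a + i b, of the
    complexified matrix of D. *)
Lemma complex_eigenvector S D n : subspace S -> linear_on S D ->
  (forall u, S u -> S (D u)) -> has_dim S n ->
  (exists2 u, S u & u <> fun=> 0) ->
  exists (v w : fn) (a b : R), [/\ S v, S w, (v <> (fun=> 0)) \/ (w <> fun=> 0),
    D v = (fun p => a * v p - b * w p) & D w = (fun p => b * v p + a * w p)].
Proof.
move=> sS lD DS [f [Sf fi fs]] [u Su u0].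
have n0 : (0 < n)%N.
  case: n f Sf fi fs => // f _ _ fs; exfalso; apply: u0; have [c ->] := fs _ Su.
  by apply/funext => p; rewrite /comb big_ord0.
have [M ME] := span_matrix fs (fun i => DS _ (Sf i)).
pose MC := map_mx (real_complex R) M.
have [z] := eigenvalue_closed MC n0.
move=> /eigenvalueP[x xM x0].
pose va : 'rV[R]_n := \row_i complex.Re (x ord0 i).
pose wa : 'rV[R]_n := \row_i complex.Im (x ord0 i).
pose a := complex.Re z; pose b := complex.Im z.
have vM : va *m M = a *: va - b *: wa.
  apply/rowP => j; have /rowP/(_ j) := xM; rewrite !mxE => /(congr1 (@complex.Re _)).
  rewrite raddf_sum /= => H. 
  transitivity (complex.Re (z * x ord0 j)); last first.
    by rewrite /a /b; case: (z) (x ord0 j) => [? ?] [? ?].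
  rewrite -H; apply: eq_bigr => i _; rewrite !mxE.
  by case: (x ord0 i) => p q /=; rewrite mulr0 subr0.
have wM : wa *m M = b *: va + a *: wa.
  apply/rowP => j; have /rowP/(_ j) := xM; rewrite !mxE => /(congr1 (@complex.Im _)).
  rewrite raddf_sum /= => H.
  transitivity (complex.Im (z * x ord0 j)); last first.
    by rewrite /a /b; case: (z) (x ord0 j) => [? ?] [? ?] /=; rewrite addrC.
  rewrite -H; apply: eq_bigr => i _; rewrite !mxE.
  by case: (x ord0 i) => p q /=; rewrite mulr0 add0r.
have Dc (y : 'rV[R]_n) : D (comb (y ord0) f) = comb ((y *m M) ord0) f.
  rewrite (linear_on_comb _ sS lD Sf) ME comb_comb.
  by congr (comb ((_ *m _) _)); apply/rowP => i; rewrite mxE.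
exists (comb (va ord0) f), (comb (wa ord0) f), a, b; split.
- exact: subspace_comb.
- exact: subspace_comb.
- apply/not_andP => -[/(lin_indepP _).1 v0 /(lin_indepP _).1 w0].
  move/eqP: x0; apply; apply/rowP => i; rewrite mxE.
  have /rowP/(_ i) := v0 fi; have /rowP/(_ i) := w0 fi; rewrite !mxE.
  by case: (x ord0 i) => p q /= -> ->.
- rewrite Dc vM; apply/funext => p; rewrite /comb !mulr_sumr -sumrB.
  by apply: eq_bigr => i _; rewrite !mxE; ring.
- rewrite Dc wM; apply/funext => p; rewrite /comb !mulr_sumr -big_split /=.
  by apply: eq_bigr => i _; rewrite !mxE; ring.
Qed.

End LinearAlgebra.

(** * Eigenspaces and the glide reflection *)

Section Eigenspaces.
Set Implicit Arguments.
Unset Strict Implicit.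
Local Open Scope classical_set_scope.
Local Open Scope ring_scope.
Variable R : realType.
Local Notation fn := (R * R -> R).
Implicit Types (u v : fn) (lam e : R).

Definition glide u : fn := fun p => u (1 - p.1, p.2 + 1).

Lemma pd1_lin (a b : R) u v : smooth u -> smooth v ->
  pd1 (fun p => a * u p + b * v p) = (fun p => a * pd1 u p + b * pd1 v p).
Proof.
move=> su sv; apply/funext => -[x y]; apply: pd1E.
have du := pd1P x y su; have dv := pd1P x y sv.
exact: (is_deriveD (is_deriveZ a du) (is_deriveZ b dv)).
Qed.

Lemma pd2_lin (a b : R) u v : smooth u -> smooth v ->
  pd2 (fun p => a * u p + b * v p) = (fun p => a * pd2 u p + b * pd2 v p).
Proof.
move=> su sv; apply/funext => -[x y]; apply: pd2E.
have du := pd2P x y su; have dv := pd2P x y sv.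
exact: (is_deriveD (is_deriveZ a du) (is_deriveZ b dv)).
Qed.

(** The induction on the order of differentiability runs over all smooth
    functions at once, since derivatives of smooth functions are smooth. *)
Lemma smooth_lin (a b : R) u v : smooth u -> smooth v ->
  smooth (fun p => a * u p + b * v p).
Proof.
move=> su sv k; elim: k u v su sv => [|k IH] u v su sv /=;
  (split; first by move=> p; apply: cvgD; apply: cvgMr; exact: smooth_continuous).
  by [].
split.
- by move=> [x y]; apply: ex_derive; apply/line1; apply: is_deriveD;
    apply: is_deriveZ; exact: pd1P.
- by move=> [x y]; apply: ex_derive; apply/line2; apply: is_deriveD;
    apply: is_deriveZ; exact: pd2P.
- by rewrite pd1_lin //; apply: IH; exact: smooth_pd1.
- by rewrite pd2_lin //; apply: IH; exact: smooth_pd2.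
Qed.

Lemma glide_derive1 u (x y : R) : smooth u ->
  is_derive x 1 (fun s => glide u (s, y)) (- pd1 u (1 - x, y + 1)).
Proof.
move=> su; have D := pd1P (1 - x) (y + 1) su.
have D1 : is_derive x (1 : R) (fun s : R => 1 - s) (- 1).
  by have := is_deriveB (is_derive_cst (1 : R) x 1) (is_derive_id x (1 : R)); rewrite sub0r.
have := @is_derive1_comp _ (fun s => u (s, y + 1)) (fun s => 1 - s) x _ _ D D1.
by rewrite mulrN1.
Qed.

Lemma glide_derive2 u (x y : R) : smooth u ->
  is_derive y 1 (fun s => glide u (x, s)) (pd2 u (1 - x, y + 1)).
Proof.
move=> su; have D := pd2P (1 - x) (y + 1) su.
have D1 : is_derive y (1 : R) (fun s : R => s + 1) 1.
  exact: is_derive_shift.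
have := @is_derive1_comp _ (fun s => u (1 - x, s)) (fun s => s + 1) y _ _ D D1.
by rewrite mulr1.
Qed.

Lemma pd1_glide u : smooth u -> pd1 (glide u) = (fun p => - glide (pd1 u) p).
Proof. by move=> su; apply/funext => -[x y]; apply: pd1E; exact: glide_derive1. Qed.

Lemma pd2_glide u : smooth u -> pd2 (glide u) = glide (pd2 u).
Proof. by move=> su; apply/funext => -[x y]; apply: pd2E; exact: glide_derive2. Qed.

Lemma glide_continuous u : smooth u -> continuous (glide u).
Proof.
move=> su [x y].
apply: (@continuous_comp _ _ _ (fun p : R * R => (1 - p.1, p.2 + 1)) u);
  last exact: smooth_continuous.
have c1 : (1 - p.1 : R) @[p --> (x, y)] --> (1 - x : R).
  by apply: cvgB; [exact: cvg_cst|exact: cvg_fst].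
have c2 : (p.2 + 1 : R) @[p --> (x, y)] --> (y + 1 : R).
  by apply: cvgD; [exact: cvg_snd|exact: cvg_cst].
exact: (cvg_pair c1 c2).
Qed.

(** The induction carries a scalar, because the derivative in x of a reflected
    function picks up a sign. *)
Lemma smooth_glide u : smooth u -> smooth (glide u).
Proof.
suff H k (a : R) : smooth u -> is_Ck k (fun p => a * glide u p).
  move=> su k; have := H k 1 su.
  by rewrite (_ : (fun p => _) = glide u) //; apply/funext => p; rewrite mul1r.
elim: k a u => [|k IH] a u su /=; split=> //.
  by move=> p; apply: cvgMr; exact: glide_continuous.
  by move=> p; apply: cvgMr; exact: glide_continuous.
have Z1 : pd1 (fun p => a * glide u p) = (fun p => (- a) * glide (pd1 u) p).
  apply/funext => -[x y]; apply: pd1E; rewrite mulNr -mulrN.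
  by apply: is_deriveZ; exact: glide_derive1.
have Z2 : pd2 (fun p => a * glide u p) = (fun p => a * glide (pd2 u) p).
  apply/funext => -[x y]; apply: pd2E.
  by apply: is_deriveZ; exact: glide_derive2.
split.
- by move=> [x y]; apply: ex_derive; apply/line1; apply: is_deriveZ; exact: glide_derive1.
- by move=> [x y]; apply: ex_derive; apply/line2; apply: is_deriveZ; exact: glide_derive2.
- by rewrite Z1; apply: IH; exact: smooth_pd1.
- by rewrite Z2; apply: IH; exact: smooth_pd2.
Qed.

Definition torus_space lam := lap_eigenspace (T12_functions R) lam.

(** For e = 1 this is the eigenspace of the Klein bottle, for e = - 1 its
    antisymmetric counterpart. *)
Definition glide_space e lam : set fn := [set u | torus_space lam u /\ glide u = fun p => e * u p].

Lemma pd1_0 : pd1 (fun=> 0 : R) = fun=> 0.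
Proof. by apply/funext => -[x y]; apply: pd1E; exact: is_derive_cst. Qed.

Lemma pd2_0 : pd2 (fun=> 0 : R) = fun=> 0.
Proof. by apply/funext => -[x y]; apply: pd2E; exact: is_derive_cst. Qed.

Lemma smooth_subspace : subspace (@smooth R).
Proof.
split; last by move=> a b u v; exact: smooth_lin.
elim=> [|k IH] /=; (split; first by move=> p; exact: cvg_cst); first by [].
by rewrite pd1_0 pd2_0; split=> // -[x y]; exact: derivable_cst.
Qed.

Lemma linear_on_pd1 : linear_on (@smooth R) (@pd1 R).
Proof. by move=> a b u v; exact: pd1_lin. Qed.

Lemma linear_on_pd2 : linear_on (@smooth R) (@pd2 R).
Proof. by move=> a b u v; exact: pd2_lin. Qed.

Lemma torus_smooth lam u : torus_space lam u -> smooth u.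
Proof. by move=> [[]]. Qed.

Lemma torus_per1 lam u (x y : R) : torus_space lam u -> u (x + 1, y) = u (x, y).
Proof. by move=> [[]]. Qed.

Lemma torus_per2 lam u (x y : R) : torus_space lam u -> u (x, y + 2) = u (x, y).
Proof. by move=> [[]]. Qed.

Lemma torus_lap lam u p : torus_space lam u -> pd1 (pd1 u) p + pd2 (pd2 u) p = - lam * u p.
Proof. by move=> [_ /(_ p)]; rewrite /laplacian mulNr => <-; rewrite opprK. Qed.

Lemma torus_intro lam u : smooth u -> (forall x y, u (x + 1, y) = u (x, y)) ->
  (forall x y, u (x, y + 2) = u (x, y)) ->
  (forall p, pd1 (pd1 u) p + pd2 (pd2 u) p = - lam * u p) -> torus_space lam u.
Proof. by move=> su p1 p2 E; split=> // p; rewrite /laplacian E mulNr opprK. Qed.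

Lemma torus_subspace lam : subspace (torus_space lam).
Proof.
split.
  apply: torus_intro => //; first exact: smooth_subspace.1.
  by move=> p; rewrite !pd1_0 !pd2_0 mulr0 addr0.
move=> a b u v Vu Vv; have su := torus_smooth Vu; have sv := torus_smooth Vv.
apply: torus_intro; first exact: smooth_lin.
- by move=> x y; rewrite (torus_per1 x y Vu) (torus_per1 x y Vv).
- by move=> x y; rewrite (torus_per2 x y Vu) (torus_per2 x y Vv).
move=> p; rewrite (pd1_lin a b su sv) (pd2_lin a b su sv).
rewrite (pd1_lin a b (smooth_pd1 su) (smooth_pd1 sv)).
rewrite (pd2_lin a b (smooth_pd2 su) (smooth_pd2 sv)).
have lin (r1 r2 r3 r4 s1 s2 : R) : r1 + r2 = - lam * s1 -> r3 + r4 = - lam * s2 ->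
    a * r1 + b * r3 + (a * r2 + b * r4) = - lam * (a * s1 + b * s2).
  by move=> E1 E2; rewrite addrACA -!mulrDr E1 E2; ring.
exact: (lin _ _ _ _ _ _ (torus_lap p Vu) (torus_lap p Vv)).
Qed.

Lemma pd1_per u (x y s t : R) : smooth u -> (forall x y, u (x + s, y + t) = u (x, y)) ->
  pd1 u (x + s, y + t) = pd1 u (x, y).
Proof.
move=> su pu; apply/esym/pd1E.
have D := pd1P (x + s) (y + t) su.
have D1 : is_derive x (1 : R) (fun r : R => r + s) 1.
  exact: is_derive_shift.
have := @is_derive1_comp _ (fun r => u (r, y + t)) (fun r => r + s) x _ _ D D1.
by rewrite mulr1; congr is_derive; apply/funext => r /=; rewrite pu.
Qed.

Lemma pd2_per u (x y s t : R) : smooth u -> (forall x y, u (x + s, y + t) = u (x, y)) ->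
  pd2 u (x + s, y + t) = pd2 u (x, y).
Proof.
move=> su pu; apply/esym/pd2E.
have D := pd2P (x + s) (y + t) su.
have D1 : is_derive y (1 : R) (fun r : R => r + t) 1.
  exact: is_derive_shift.
have := @is_derive1_comp _ (fun r => u (x + s, r)) (fun r => r + t) y _ _ D D1.
by rewrite mulr1; congr is_derive; apply/funext => r /=; rewrite pu.
Qed.

(** Linearity of d/dx and d/dy is stated for combinations of exactly two
    functions; the eigenvalue equation is put in this form to be differentiated. *)
Let pad_eq (a b c d : R) : a + b = c -> 1 * a + 1 * b = c + 0 * d.
Proof. by rewrite !mul1r mul0r addr0. Qed.

Let unpad_eq (a b c d : R) : 1 * a + 1 * b = c + 0 * d -> a + b = c.
Proof. by rewrite !mul1r mul0r addr0. Qed.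

Lemma torus_pd1 lam u : torus_space lam u -> torus_space lam (pd1 u).
Proof.
move=> Vu; have su := torus_smooth Vu; apply: torus_intro; first exact: smooth_pd1.
- move=> x y; have := @pd1_per u x y 1 0 su; rewrite addr0; apply => s t.
  by rewrite addr0 (torus_per1 _ _ Vu).
- move=> x y; have := @pd1_per u x y 0 2 su; rewrite addr0; apply => s t.
  by rewrite addr0 (torus_per2 _ _ Vu).
move=> p; rewrite -(pd_commute su) -(pd_commute (smooth_pd2 su)).
have E : (fun p => 1 * pd1 (pd1 u) p + 1 * pd2 (pd2 u) p) = (fun p => - lam * u p + 0 * u p).
  by apply/funext => q; exact: pad_eq (torus_lap q Vu).
have := congr1 (fun w => pd1 w p) E.
rewrite (pd1_lin _ _ (smooth_pd1 (smooth_pd1 su)) (smooth_pd2 (smooth_pd2 su))).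
by rewrite (pd1_lin _ _ su su); exact: unpad_eq.
Qed.

Lemma torus_pd2 lam u : torus_space lam u -> torus_space lam (pd2 u).
Proof.
move=> Vu; have su := torus_smooth Vu; apply: torus_intro; first exact: smooth_pd2.
- move=> x y; have := @pd2_per u x y 1 0 su; rewrite addr0; apply => s t.
  by rewrite addr0 (torus_per1 _ _ Vu).
- move=> x y; have := @pd2_per u x y 0 2 su; rewrite addr0; apply => s t.
  by rewrite addr0 (torus_per2 _ _ Vu).
move=> p; rewrite (pd_commute su) (pd_commute (smooth_pd1 su)).
have E : (fun p => 1 * pd1 (pd1 u) p + 1 * pd2 (pd2 u) p) = (fun p => - lam * u p + 0 * u p).
  by apply/funext => q; exact: pad_eq (torus_lap q Vu).
have := congr1 (fun w => pd2 w p) E.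
rewrite (pd2_lin _ _ (smooth_pd1 (smooth_pd1 su)) (smooth_pd2 (smooth_pd2 su))).
by rewrite (pd2_lin _ _ su su); exact: unpad_eq.
Qed.

Lemma glide_space_subspace e lam : subspace (glide_space e lam).
Proof.
have [V0 VD] := torus_subspace lam; split; first by split=> //; apply/funext => p; rewrite mulr0.
move=> a b u v [Vu gu] [Vv gv]; split; first exact: VD.
apply/funext => p; have := congr1 (fun w => w p) gu; have := congr1 (fun w => w p) gv.
by rewrite /glide /= => -> ->; ring.
Qed.

(** The glide reflection reverses x, hence anticommutes with d/dx. *)
Lemma glide_space_pd1 e lam u : glide_space e lam u -> glide_space (- e) lam (pd1 u).
Proof.
move=> [Vu gu]; split; first exact: torus_pd1.
have su := torus_smooth Vu.
have := pd1_glide su; rewrite gu => E; apply/funext => p; apply: oppr_inj.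
rewrite -[LHS](congr1 (fun w => w p) E) -mulNr opprK.
rewrite (_ : (fun p => e * u p) = fun p => e * u p + 0 * u p) ?pd1_lin ?mul0r ?addr0 //.
by apply/funext => q; rewrite mul0r addr0.
Qed.

Lemma torus_glide lam u : torus_space lam u -> torus_space lam (glide u).
Proof.
move=> Vu; have su := torus_smooth Vu; apply: torus_intro; first exact: smooth_glide.
- move=> x y; rewrite /glide /= -(torus_per1 (1 - (x + 1)) _ Vu); congr (u (_, _)); ring.
- move=> x y; rewrite /glide /= -(torus_per2 _ (y + 1) Vu); congr (u (_, _)); ring.
move=> p; rewrite (pd1_glide su) (pd2_glide su) (pd2_glide (smooth_pd2 su)).
have -> : (fun p => - glide (pd1 u) p) =
    (fun p => -1 * glide (pd1 u) p + 0 * glide (pd1 u) p).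
  by apply/funext => q; rewrite mulN1r mul0r addr0.
have sg := smooth_glide (smooth_pd1 su).
rewrite (pd1_lin _ _ sg sg) mul0r addr0 (pd1_glide (smooth_pd1 su)) mulN1r opprK.
exact: (torus_lap (1 - p.1, p.2 + 1) Vu).
Qed.

Lemma glideK lam u : torus_space lam u -> glide (glide u) = u.
Proof.
move=> Vu; apply/funext => -[x y]; rewrite /glide /= -[RHS](torus_per2 _ _ Vu).
congr (u (_, _)); ring.
Qed.

(** u is the sum of (u + u o g) / 2 and (u - u o g) / 2, g being an involution
    on functions of period 2 in y. *)
Lemma torus_direct_sum lam m n :
  has_dim (glide_space 1 lam) m -> has_dim (glide_space (- 1) lam) n ->
  has_dim (torus_space lam) (m + n).
Proof.
apply: has_dim_direct_sum.
- by move=> u [].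
- by move=> u [].
- move=> u v [Vu gu] [Vv gv] uv0.
  have U p : u p = 0.
    have := congr1 (fun w => w (1 - p.1, p.2 + 1)) uv0.
    have := congr1 (fun w => w p) uv0; rewrite /=.
    rewrite -[u (_, _)]/(glide u p) -[v (_, _)]/(glide v p) gu gv; lra.
  split; apply/funext => p; first exact: U.
  by have := congr1 (fun w => w p) uv0; rewrite /= U add0r.
- move=> u Vu; have Vg := torus_glide Vu; have [_ VD] := torus_subspace lam.
  exists (fun p => 2^-1 * u p + 2^-1 * glide u p), (fun p => 2^-1 * u p + - 2^-1 * glide u p).
  have gg p : u (1 - (1 - p.1), p.2 + 1 + 1) = u p.
    by rewrite -[RHS](congr1 (fun w => w p) (glideK Vu)).
  split.
  + split; first exact: VD.
    by apply/funext => p; rewrite /glide /= gg; ring.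
  + split; first exact: VD.
    by apply/funext => p; rewrite /glide /= gg; ring.
  + by apply/funext => p; field.
- exact: glide_space_subspace.
- exact: glide_space_subspace.
Qed.

(** Period 2 in y comes for free on the Klein bottle: the square of the glide
    reflection is the translation by (0, 2). *)
Lemma KB_eigenspace lam : lap_eigenspace (KB_functions R) lam = glide_space 1 lam.
Proof.
apply/seteqP; split=> u.
  move=> [[su p1 gu] E].
  have p2 x y : u (x, y + 2) = u (x, y).
    rewrite -[RHS]gu -[RHS]gu; congr (u (_, _)); ring.
  split; first by split.
  by apply/funext => -[x y]; rewrite /glide /= gu mul1r.
move=> [[[su p1 p2] E] gu]; split=> //; split=> // x y.
by have := congr1 (fun w => w (x, y)) gu; rewrite mul1r.
Qed.

End Eigenspaces.

(** * Gradient bound and finite dimension *)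

Section MaximumPrinciple.
Set Implicit Arguments.
Unset Strict Implicit.
Local Open Scope classical_set_scope.
Local Open Scope ring_scope.
Variable R : realType.
Local Notation fn := (R * R -> R).
Implicit Types (u v : fn) (lam e : R).

Lemma periodic_int (f : R -> R) (T : R) : (forall x, f (x + T) = f x) ->
  forall x (m : int), f (x + m%:~R * T) = f x.
Proof.
move=> fT; have fn x n : f (x + n%:R * T) = f x.
  elim: n x => [|n IH] x; first by rewrite mul0r addr0.
  by rewrite -natr1 mulrDl mul1r addrA fT IH.
move=> x [n|n]; first exact: fn.
by rewrite NegzE mulrNz mulNr -[in RHS](subrK (n.+1%:R * T) x) fn.
Qed.

Lemma torus_max (w : fn) : continuous w -> (forall x y, w (x + 1, y) = w (x, y)) ->
  (forall x y, w (x, y + 2) = w (x, y)) ->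
  exists x0 y0, [/\ 0 <= x0 <= 1, 0 <= y0 <= 2 & forall x y, w (x, y) <= w (x0, y0)].
Proof.
move=> cw p1 p2.
have [||[x0 y0]] := @compact_EVT_max _ R w (`[0, 1] `*` `[0, 2]) _
    (compact_setX (@segment_compact R 0 1) (@segment_compact R 0 2)).
- by exists (0, 0); split; rewrite /= in_itv /= lexx /= ?ler01 ?ler0n.
- exact: continuous_subspaceT.
rewrite inE => -[/= x01 y02] wmax; exists x0, y0.
rewrite !in_itv /= in x01 y02; split=> // x y.
pose m := Num.floor x; pose k := Num.floor (y / 2).
have -> : w (x, y) = w (x + (- m)%:~R * 1, y + (- k)%:~R * 2).
  rewrite (periodic_int (f := fun s => w (s, _)) (fun s => p1 s _)).
  by rewrite (periodic_int (f := fun s => w (_, s)) (p2 _)).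
apply: wmax; rewrite inE; split; rewrite /= in_itv /= mulrNz.
  have := floor_itv x; rewrite -/m mulr1 intrD => /andP[]; lra.
have := floor_itv (y / 2); rewrite -/k intrD => /andP[]; lra.
Qed.

(** First and second order conditions along one axis at a maximum of
    g^2 + h^2 + a u^2, where g is the derivative of u along that axis and h its
    other partial derivative. *)
Lemma energy_line (u g h r s rr ss : R -> R) (a x0 : R) :
  (forall x : R, is_derive x 1 u (g x)) -> (forall x : R, is_derive x 1 g (r x)) ->
  (forall x : R, is_derive x 1 h (s x)) -> (forall x : R, is_derive x 1 r (rr x)) ->
  (forall x : R, is_derive x 1 s (ss x)) ->
  (forall x, g x ^+ 2 + h x ^+ 2 + a * u x ^+ 2
             <= g x0 ^+ 2 + h x0 ^+ 2 + a * u x0 ^+ 2) ->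
  g x0 * r x0 + h x0 * s x0 + a * (u x0 * g x0) = 0 /\
  r x0 ^+ 2 + g x0 * rr x0 + (s x0 ^+ 2 + h x0 * ss x0)
    + a * (g x0 ^+ 2 + u x0 * r x0) <= 0.
Proof.
move=> du dg dh dr ds Pmax.
have D1 x : is_derive x (1 : R) (fun x => g x * g x + h x * h x + a * (u x * u x))
    (2 * (g x * r x + h x * s x + a * (u x * g x))).
  have := is_deriveD (is_deriveD (is_deriveM (dg x) (dg x)) (is_deriveM (dh x) (dh x)))
    (is_deriveZ a (is_deriveM (du x) (du x))).
  by move=> H; apply: (is_derive_eq H); rewrite /GRing.scale /=; ring.
have D2 : is_derive x0 (1 : R) (fun x => 2 * (g x * r x + h x * s x + a * (u x * g x)))
    (2 * (r x0 ^+ 2 + g x0 * rr x0 + (s x0 ^+ 2 + h x0 * ss x0)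
    + a * (g x0 ^+ 2 + u x0 * r x0))).
  have := is_deriveZ 2 (is_deriveD
    (is_deriveD (is_deriveM (dg x0) (dr x0)) (is_deriveM (dh x0) (ds x0)))
    (is_deriveZ a (is_deriveM (du x0) (dg x0)))).
  by move=> H; apply: (is_derive_eq H); rewrite /GRing.scale /=; ring.
have [|E I] := derive_at_max D1 D2.
  by move=> x; have := Pmax x; rewrite !expr2.
split; lra.
Qed.

(** The pointwise inequality behind the gradient bound. Here g, h is the
    gradient of u and r, s, q its Hessian. The first order conditions say that
    the gradient is an eigenvector of the Hessian with eigenvalue - a u, so a
    nonzero gradient gives r^2 + 2 s^2 + q^2 >= a^2 u^2. The sum of the second
    order conditions and the eigenvalue equation then give
    (a - lam) (a u^2 + g^2 + h^2) <= 0, which is absurd for lam < a. *)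
Lemma hessian_bound (a lam u g h r s s' q rx sx sy qy : R) : 0 < a -> lam < a ->
  s' = s -> g * r + h * s' + a * (u * g) = 0 -> h * q + g * s + a * (u * h) = 0 ->
  r ^+ 2 + g * rx + (s' ^+ 2 + h * sx) + a * (g ^+ 2 + u * r) <= 0 ->
  q ^+ 2 + h * qy + (s ^+ 2 + g * sy) + a * (h ^+ 2 + u * q) <= 0 ->
  r + q = - lam * u -> rx + sy = - lam * g -> sx + qy = - lam * h ->
  g ^+ 2 + h ^+ 2 = 0.
Proof.
move=> a0 la -> E1 E2 I1 I2 L1 L2 L3.
apply/eqP; rewrite eq_le addr_ge0 ?sqr_ge0 // andbT leNgt; apply/negP => G0.
have H : a ^+ 2 * u ^+ 2 <= r ^+ 2 + 2 * s ^+ 2 + q ^+ 2.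
  rewrite -(ler_pM2r G0).
  have -> : a ^+ 2 * u ^+ 2 * (g ^+ 2 + h ^+ 2) = (g * r + h * s) ^+ 2 + (h * q + g * s) ^+ 2.
    have -> : g * r + h * s = - (a * (u * g)) by apply/eqP; rewrite -addr_eq0 E1.
    have -> : h * q + g * s = - (a * (u * h)) by apply/eqP; rewrite -addr_eq0 E2.
    ring.
  rewrite -subr_ge0.
  have -> : (r ^+ 2 + 2 * s ^+ 2 + q ^+ 2) * (g ^+ 2 + h ^+ 2) -
     ((g * r + h * s) ^+ 2 + (h * q + g * s) ^+ 2) =
     (g * s - h * r) ^+ 2 + (g * q - h * s) ^+ 2 by ring.
  by rewrite addr_ge0 ?sqr_ge0.
have I3 : r ^+ 2 + 2 * s ^+ 2 + q ^+ 2 + (g * (rx + sy) + h * (sx + qy))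
    + a * (g ^+ 2 + h ^+ 2) + a * u * (r + q) <= 0 by lra.
rewrite L1 L2 L3 in I3.
have : (a - lam) * (a * u ^+ 2 + (g ^+ 2 + h ^+ 2)) <= 0 by lra.
rewrite leNgt => /negP; apply; rewrite mulr_gt0 ?subr_gt0 //.
by rewrite ltr_wpDl // mulr_ge0 ?sqr_ge0 ?ltW.
Qed.

Let sum_ge (x y z d : R) : 0 <= x -> 0 <= y -> 0 <= z -> x + y + z <= d ->
  x <= d /\ y <= d.
Proof. by move=> *; split; lra. Qed.

(** At a maximum of |grad u|^2 + a u^2 the gradient vanishes by
    [hessian_bound], so this quantity is everywhere at most a times the maximum
    of u^2. *)
Lemma bernstein lam u a : torus_space lam u -> 0 < a -> lam < a ->
  exists x0 y0, [/\ 0 <= x0 <= 1, 0 <= y0 <= 2 & forall x y,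
    [/\ u (x, y) ^+ 2 <= u (x0, y0) ^+ 2, pd1 u (x, y) ^+ 2 <= a * u (x0, y0) ^+ 2
      & pd2 u (x, y) ^+ 2 <= a * u (x0, y0) ^+ 2]].
Proof.
move=> Vu a0 la.
have Vg := torus_pd1 Vu; have Vh := torus_pd2 Vu.
have su := torus_smooth Vu; have sg := torus_smooth Vg; have sh := torus_smooth Vh.
have csqr (w : fn) : continuous w -> continuous (fun p => w p ^+ 2).
  move=> cw; have -> : (fun p => w p ^+ 2) = (fun p => w p * w p).
    by apply/funext => p; rewrite expr2.
  by move=> p; apply: cvgM; exact: cw.
have cu := smooth_continuous su; have cg := smooth_continuous sg; have ch := smooth_continuous sh.
have [x0 [y0 [x01 y02 umax]]] := torus_max (csqr _ cu)
  (fun x y => congr1 (@GRing.exp R ^~ 2%N) (torus_per1 x y Vu))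
  (fun x y => congr1 (@GRing.exp R ^~ 2%N) (torus_per2 x y Vu)).
exists x0, y0; split=> //.
pose P p := pd1 u p ^+ 2 + pd2 u p ^+ 2 + a * u p ^+ 2.
have cP : continuous P.
  move=> p; apply: cvgD; last by apply: cvgMr; exact: csqr.
  by apply: cvgD; exact: csqr.
have P1 x y : P (x + 1, y) = P (x, y).
  by rewrite /P (torus_per1 x y Vu) (torus_per1 x y Vg) (torus_per1 x y Vh).
have P2 x y : P (x, y + 2) = P (x, y).
  by rewrite /P (torus_per2 x y Vu) (torus_per2 x y Vg) (torus_per2 x y Vh).
have [x1 [y1 [_ _ Pmax]]] := torus_max cP P1 P2.
have [E1 I1] := energy_line (fun x => pd1P x y1 su) (fun x => pd1P x y1 sg)
  (fun x => pd1P x y1 sh) (fun x => pd1P x y1 (smooth_pd1 sg))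
  (fun x => pd1P x y1 (smooth_pd1 sh)) (fun x => Pmax x y1).
have Pmax2 y : pd2 u (x1, y) ^+ 2 + pd1 u (x1, y) ^+ 2 + a * u (x1, y) ^+ 2 <=
    pd2 u (x1, y1) ^+ 2 + pd1 u (x1, y1) ^+ 2 + a * u (x1, y1) ^+ 2.
  have swap (A B E A' B' E' : R) : A + B + E <= A' + B' + E' -> B + A + E <= B' + A' + E'.
    by rewrite (addrC A) (addrC A').
  exact: swap (Pmax x1 y).
(* Along the y-axis the two components of the gradient exchange their roles. *)
have [E2 I2] := energy_line (fun y => pd2P x1 y su) (fun y => pd2P x1 y sh)
  (fun y => pd2P x1 y sg) (fun y => pd2P x1 y (smooth_pd2 sh))
  (fun y => pd2P x1 y (smooth_pd2 sg)) Pmax2.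
have C := congr1 (fun w => w (x1, y1)) (pd_commute su); rewrite /= in C.
have G0 := hessian_bound a0 la C E1 E2 I1 I2 (torus_lap _ Vu) (torus_lap _ Vg) (torus_lap _ Vh).
move=> x y; have Px := Pmax x y; have ux := umax x y.
have u1 : a * u (x1, y1) ^+ 2 <= a * u (x0, y0) ^+ 2 by rewrite ler_pM2l.
have P0 : P (x, y) <= a * u (x0, y0) ^+ 2.
  by apply: (le_trans Px); rewrite /P G0 add0r.
have au : 0 <= a * u (x, y) ^+ 2 by rewrite mulr_ge0 ?sqr_ge0 ?ltW.
have [gx hx] := sum_ge (sqr_ge0 _) (sqr_ge0 _) au P0.
by split; [exact: ux|exact: gx|exact: hx].
Qed.

Lemma lipschitz_line (f df : R -> R) (L a b : R) : (forall x : R, is_derive x 1 f (df x)) ->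
  (forall x, `|df x| <= L) -> a <= b -> `|f b - f a| <= L * (b - a).
Proof.
move=> D B; rewrite le_eqVlt => /orP[/eqP->|ab].
  by rewrite !subrr normr0 mulr0.
have [c [_ _ ->]] := mean_value ab D.
by rewrite normrM (gtr0_norm (_ : 0 < b - a)) ?subr_gt0 // ler_wpM2r // subr_ge0 ltW.
Qed.

Let two_steps (a c d A B : R) : `|a - c| <= A -> `|c - d| <= B -> d = 0 -> `|a| <= A + B.
Proof.
move=> ac cd d0; rewrite -[a](subrK c) (le_trans (ler_normD _ _)) // lerD //.
by rewrite -[c]subr0 -d0.
Qed.

(** The points form a grid of mesh 1 / N. From a grid point to a maximum of |u|
    there are two steps of length at most 1 / N along the axes, so if u
    vanishes on the grid then max |u| <= (2 b / N) max |u|, where b bounds the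
    partial derivatives relative to max |u|; and N > 2 b. *)
Lemma torus_points lam : exists N (p : 'I_N -> R * R),
  forall u, torus_space lam u -> (forall j, u (p j) = 0) -> u = fun=> 0.
Proof.
(* Any b with b^2 > lam bounds the partial derivatives relative to max |u|. *)
pose b := 1 + `|lam|.
have b0 : 0 < b by rewrite /b ltr_pwDl.
have lb : lam < b ^+ 2.
  have := ler_norm lam; have : 0 <= `|lam| by []. rewrite /b; nra.
pose N := (Num.truncn (2 * b)).+1.
have bN : 2 * b < N%:R by rewrite truncnS_gt // mulr_ge0 // ltW.
have N0 : 0 < N%:R :> R by rewrite ltr0n.
pose I := ('I_N.+1 * 'I_(2 * N).+1)%type.
pose p (k : 'I_#|{: I}|) : R * R := ((enum_val k).1%:R / N%:R, (enum_val k).2%:R / N%:R).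
exists #|{: I}|, p => u Vu u0.
have ugrid (i j : nat) : (i <= N)%N -> (j <= 2 * N)%N -> u (i%:R / N%:R, j%:R / N%:R) = 0.
  move=> iN jN; pose q : I := (Ordinal (iN : (i < N.+1)%N), Ordinal (jN : (j < (2 * N).+1)%N)).
  by have := u0 (enum_rank q); rewrite /p enum_rankK.
have su := torus_smooth Vu.
have [x0 [y0 [x01 y02 H]]] := bernstein Vu (exprn_gt0 2 b0) lb.
pose M := `|u (x0, y0)|.
have sqr_norm (z : R) : z ^+ 2 <= b ^+ 2 * u (x0, y0) ^+ 2 -> `|z| <= b * M.
  rewrite -[z ^+ 2]real_normK ?num_real // -[u _ ^+ 2]real_normK ?num_real // -exprMn.
  by rewrite ler_pXn2r // nnegrE // mulr_ge0 // ltW.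
have B1 x y : `|pd1 u (x, y)| <= b * M by have [_ B _] := H x y; exact: sqr_norm B.
have B2 x y : `|pd2 u (x, y)| <= b * M by have [_ _ B] := H x y; exact: sqr_norm B.
have grid (z : R) (K : nat) : 0 <= z <= K%:R ->
    exists i : nat, [/\ (i <= K * N)%N, i%:R / N%:R <= z & z - i%:R / N%:R <= N%:R^-1].
  move=> /andP[z0 zK]; have zN0 : 0 <= z * N%:R by rewrite mulr_ge0 // ltW.
  have /andP[t1 t2] := truncn_itv zN0.
  exists (Num.truncn (z * N%:R)); split.
  - by rewrite -(ler_nat R) natrM (le_trans t1) // ler_wpM2r // ltW.
  - by rewrite ler_pdivrMr.
  - by rewrite lerBlDr -[X in X + _]mul1r -mulrDl ler_pdivlMr // addrC natr1 ltW.
have [|i [iN i1 i2]] := grid x0 1%N; first by [].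
have [|j [jN j1 j2]] := grid y0 2%N; first by [].
rewrite mul1n in iN.
have D1 := lipschitz_line (fun x => pd1P x y0 su) (fun x => B1 x y0) i1.
have D2 := lipschitz_line (fun y => pd2P (i%:R / N%:R) y su) (fun y => B2 _ y) j1.
have ML : M <= b * M * N%:R^-1 + b * M * N%:R^-1.
  have bM : 0 <= b * M by apply: mulr_ge0; [exact: ltW|exact: normr_ge0].
  have D1' := le_trans D1 (ler_wpM2l bM i2).
  have D2' := le_trans D2 (ler_wpM2l bM j2).
  exact: two_steps D1' D2' (ugrid _ _ iN jN).
have M0 : M = 0.
  apply/eqP; rewrite eq_le normr_ge0 andbT leNgt; apply/negP => M0.
  move: ML; rewrite -mulrDl ler_pdivlMr // leNgt => /negP; apply.
  have -> : b * M + b * M = M * (2 * b) by ring.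
  by rewrite ltr_pM2l.
apply/funext => -[x y]; have [ux _ _] := H x y.
move/eqP: M0; rewrite normr_eq0 => /eqP U0; rewrite U0 expr0n /= in ux.
by apply/eqP; rewrite -sqrf_eq0 eq_le ux sqr_ge0.
Qed.

End MaximumPrinciple.

(** * Harmonic oscillators, eigenvalues, functions of y alone *)

Section Oscillators.
Set Implicit Arguments.
Unset Strict Implicit.
Local Open Scope ring_scope.
Variable R : realType.
Implicit Types (h : R -> R).

Lemma constant_of_derive0 h : (forall x : R, is_derive x 1 h 0) -> forall x y, h x = h y.
Proof. by move=> H x y; exact: is_derive_0_is_cst. Qed.

Lemma derive_cos_scale (c x : R) : is_derive x 1 (fun s => cos (c * s)) (- c * sin (c * x)).
Proof.
have D : is_derive x (1 : R) (fun s : R => c * s) c.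
  by have := is_deriveZ c (is_derive_id x (1 : R)); rewrite /GRing.scale /= mulr1.
have := @is_derive1_comp _ (@cos R) (fun s : R => c * s) x _ _ (is_derive_cos _) D.
by rewrite mulrC mulrN mulNr.
Qed.

Lemma derive_sin_scale (c x : R) : is_derive x 1 (fun s => sin (c * s)) (c * cos (c * x)).
Proof.
have D : is_derive x (1 : R) (fun s : R => c * s) c.
  by have := is_deriveZ c (is_derive_id x (1 : R)); rewrite /GRing.scale /= mulr1.
have := @is_derive1_comp _ (@sin R) (fun s : R => c * s) x _ _ (is_derive_sin _) D.
by rewrite mulrC.
Qed.

(** With k = h1 / c, the point (h, k) rotates at constant angular velocity in
    the phase plane; rotating it back gives two constants of motion, the sums
    A and B of the proof. *)
Lemma oscillator h (h1 : R -> R) (c : R) : c != 0 -> (forall x : R, is_derive x 1 h (h1 x)) ->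
  (forall x : R, is_derive x 1 h1 (- c ^+ 2 * h x)) -> forall x,
  h x = h 0 * cos (c * x) + h1 0 / c * sin (c * x) /\
  h1 x = c * (h1 0 / c * cos (c * x) - h 0 * sin (c * x)).
Proof.
move=> c0 dh dh1 x.
have A : forall x y, h x * cos (c * x) + - c^-1 * (h1 x * sin (c * x)) =
    h y * cos (c * y) + - c^-1 * (h1 y * sin (c * y)).
  apply: (@constant_of_derive0 (fun x => h x * cos (c * x) + - c^-1 * (h1 x * sin (c * x)))).
  move=> y; have := is_deriveD (is_deriveM (dh y) (derive_cos_scale c y))
    (is_deriveZ (- c^-1) (is_deriveM (dh1 y) (derive_sin_scale c y))).
  by move=> H; apply: (is_derive_eq H); rewrite /GRing.scale /=; field.
have B : forall x y, h x * sin (c * x) + c^-1 * (h1 x * cos (c * x)) =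
    h y * sin (c * y) + c^-1 * (h1 y * cos (c * y)).
  apply: (@constant_of_derive0 (fun x => h x * sin (c * x) + c^-1 * (h1 x * cos (c * x)))).
  move=> y; have := is_deriveD (is_deriveM (dh y) (derive_sin_scale c y))
    (is_deriveZ (c^-1) (is_deriveM (dh1 y) (derive_cos_scale c y))).
  by move=> H; apply: (is_derive_eq H); rewrite /GRing.scale /=; field.
have := A x 0; have := B x 0; rewrite mulr0 sin0 cos0 !mulr0 !mulr1 addr0 add0r => EB EA.
have cs := cos2Dsin2 (c * x).
rewrite -EA (mulrC (h1 0)) -EB.
move: cs; move: (cos _) (sin _) => C S cs; split.
  rewrite -[LHS]mulr1 -cs; ring.
rewrite -[LHS]mulr1 -cs; field; exact: c0.
Qed.

(** With P = h 0 and Q = h1 0 / c, the point (P, Q) is mapped to e (P, Q) by the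
    rotation of angle c T; rotations have real eigenvalue e only if they equal
    e Id. *)
Lemma oscillator_period h (h1 : R -> R) (c T e : R) : c != 0 -> (forall x : R, is_derive x 1 h (h1 x)) ->
  (forall x : R, is_derive x 1 h1 (- c ^+ 2 * h x)) ->
  h T = e * h 0 -> h1 T = e * h1 0 -> (forall x, h x = 0) \/ cos (c * T) = e /\ sin (c * T) = 0.
Proof.
move=> c0 dh dh1 hT h1T; have osc := oscillator c0 dh dh1.
have [E1 E2] := osc T; rewrite hT in E1; rewrite h1T in E2.
pose P := h 0; pose Q := h1 0 / c.
have QE : h1 0 = c * Q by rewrite /Q; field.
have E2' : e * Q = Q * cos (c * T) - P * sin (c * T).
  by apply: (mulfI c0); rewrite -E2 QE; ring.
rewrite -/P -/Q in E1.
have K : ((cos (c * T) - e) ^+ 2 + sin (c * T) ^+ 2) * (P ^+ 2 + Q ^+ 2) = 0.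
  have -> : ((cos (c * T) - e) ^+ 2 + sin (c * T) ^+ 2) * (P ^+ 2 + Q ^+ 2) =
    (P * cos (c * T) + Q * sin (c * T) - e * P) ^+ 2 +
    (Q * cos (c * T) - P * sin (c * T) - e * Q) ^+ 2 by ring.
  by rewrite -E1 -E2' !subrr expr0n addr0.
move/eqP: K; rewrite mulf_eq0 !paddr_eq0 ?sqr_ge0 // !sqrf_eq0.
move=> /orP[/andP[/eqP C /eqP S]|/andP[/eqP P0 /eqP Q0]].
  by right; split=> //; apply/eqP; rewrite -subr_eq0 C.
by left => x; have [-> _] := osc x; rewrite -/P -/Q P0 Q0 !mul0r addr0.
Qed.

(** Squares are compared so that negative x are covered by natural k. *)
Lemma sin_eq0_natmul (x : R) : sin x = 0 -> exists k : nat, x ^+ 2 = (k%:R * pi) ^+ 2.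
Proof.
wlog x0 : x / 0 <= x.
  move=> H; have [/H //|xn] := leP 0 x.
  move=> sx; have [||k kE] := H (- x); first by lra.
    by rewrite sinN sx oppr0.
  by exists k; rewrite -kE sqrrN.
move=> sx; pose k := Num.truncn (x / pi); exists k; congr (_ ^+ 2).
have p0 : 0 < pi :> R := pi_gt0 R.
have := truncn_itv (divr_ge0 x0 (ltW p0)); rewrite -/k => /andP[].
rewrite ler_pdivlMr // ltr_pdivrMr // => k1 k2.
have : sin (x - k%:R * pi) = 0.
  have := alternatingn (@sinDpi R) k (x - k%:R * pi).
  have -> : x - k%:R * pi + pi *+ k = x by rewrite mulr_natl subrK.
  by rewrite sx => /esym/eqP; rewrite mulf_eq0 signr_eq0 /= => /eqP.
move=> s0; apply/eqP; rewrite -subr_eq0 eq_le; apply/andP; split; last by rewrite subr_ge0.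
rewrite leNgt; apply/negP => d0.
have := @sin_gt0_pi R (x - k%:R * pi); rewrite s0 ltxx => /(_ _)/implyP.
have : x - k%:R * pi < pi by rewrite -natr1 in k2; lra.
by rewrite d0 => -> /(_ isT).
Qed.

Lemma period_quantum h (h1 : R -> R) (b T x0 : R) : (forall x : R, is_derive x 1 h (h1 x)) ->
  (forall x : R, is_derive x 1 h1 (- b ^+ 2 * h x)) ->
  h T = h 0 -> h1 T = h1 0 -> h x0 != 0 -> exists k : nat, (b * T) ^+ 2 = (k%:R * pi) ^+ 2.
Proof.
move=> dh dh1 hT h1T hx0; have [->|b0] := eqVneq b 0.
  by exists 0%N; rewrite !mul0r.
case: (@oscillator_period h h1 b T 1 b0 dh dh1); rewrite ?mul1r //.
  by move=> H; rewrite H eqxx in hx0.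
by move=> [_ /sin_eq0_natmul].
Qed.

End Oscillators.

Section Spectrum.
Set Implicit Arguments.
Unset Strict Implicit.
Local Open Scope classical_set_scope.
Local Open Scope ring_scope.
Variable R : realType.
Local Notation fn := (R * R -> R).
Implicit Types (u v w : fn) (lam e : R).

Lemma linear_on_sub (A B : set fn) D : A `<=` B -> linear_on B D -> linear_on A D.
Proof. by move=> AB lD a b u v /AB Bu /AB Bv; exact: lD. Qed.

Lemma torus_sub_smooth lam : torus_space lam `<=` @smooth R.
Proof. by move=> u; exact: torus_smooth. Qed.

Lemma sub_torus_has_dim lam S : subspace S -> S `<=` torus_space lam -> exists n, has_dim S n.
Proof.
move=> sS SV; have [N [p pP]] := torus_points lam.
by apply: (has_dim_points (p := p)) => // u /SV; exact: pP.
Qed.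

(** If the complex function v + i w satisfies f' = (a + i b) f, then |f|^2
    has derivative 2 a |f|^2, which must vanish at a maximum. *)
Let growth_line (v w : R -> R) (a b x0 : R) :
  (forall x : R, is_derive x 1 v (a * v x - b * w x)) ->
  (forall x : R, is_derive x 1 w (b * v x + a * w x)) ->
  (forall x, v x ^+ 2 + w x ^+ 2 <= v x0 ^+ 2 + w x0 ^+ 2) ->
  a * (v x0 ^+ 2 + w x0 ^+ 2) = 0.
Proof.
move=> dv dw qmax.
have D x : is_derive x (1 : R) (fun x => v x * v x + w x * w x)
    (2 * a * (v x * v x + w x * w x)).
  have := is_deriveD (is_deriveM (dv x) (dv x)) (is_deriveM (dw x) (dw x)).
  by move=> H; apply: (is_derive_eq H); rewrite /GRing.scale /=; ring.
have [|E _] := derive_at_max D (is_deriveZ (2 * a) (D x0)).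
  by move=> x; have := qmax x; rewrite !expr2.
by move: E; rewrite -!expr2 -mulrA => /eqP; rewrite mulf_eq0 pnatr_eq0 /= => /eqP.
Qed.

Let sqr_sum_continuous v w : continuous v -> continuous w ->
  continuous (fun p => v p ^+ 2 + w p ^+ 2).
Proof.
move=> cv cw; have -> : (fun p => v p ^+ 2 + w p ^+ 2) = (fun p => v p * v p + w p * w p).
  by apply/funext => p; rewrite !expr2.
by move=> p; apply: cvgD; apply: cvgM; [exact: cv|exact: cv|exact: cw|exact: cw].
Qed.

Let no_growth lam v w (a : R) : torus_space lam v -> torus_space lam w ->
  (forall x0 y0, (forall x y, v (x, y) ^+ 2 + w (x, y) ^+ 2 <= v (x0, y0) ^+ 2 + w (x0, y0) ^+ 2)
     -> a * (v (x0, y0) ^+ 2 + w (x0, y0) ^+ 2) = 0) ->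
  v <> (fun=> 0) \/ w <> (fun=> 0) -> a = 0.
Proof.
move=> Vv Vw H nz.
have [||x0 [y0 [_ _ qmax]]] := @torus_max R (fun p => v p ^+ 2 + w p ^+ 2)
    (sqr_sum_continuous (smooth_continuous (torus_smooth Vv)) (smooth_continuous (torus_smooth Vw))).
- by move=> x y; rewrite (torus_per1 x y Vv) (torus_per1 x y Vw).
- by move=> x y; rewrite (torus_per2 x y Vv) (torus_per2 x y Vw).
have /eqP := H _ _ qmax; rewrite mulf_eq0 => /orP[/eqP //|/eqP q0].
exfalso; have vw0 p : v p = 0 /\ w p = 0.
  case: p => x y; have := qmax x y; rewrite q0 => q1.
  have : v (x, y) ^+ 2 + w (x, y) ^+ 2 == 0 by rewrite eq_le q1 addr_ge0 // sqr_ge0.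
  by rewrite paddr_eq0 ?sqr_ge0 // !sqrf_eq0 => /andP[/eqP ? /eqP].
by case: nz; apply; apply/funext => p; have [] := vw0 p.
Qed.

Lemma pd1_no_growth lam v w (a b : R) : torus_space lam v -> torus_space lam w ->
  pd1 v = (fun p => a * v p - b * w p) -> pd1 w = (fun p => b * v p + a * w p) ->
  v <> (fun=> 0) \/ w <> (fun=> 0) -> a = 0.
Proof.
move=> Vv Vw Ev Ew; apply: (no_growth Vv Vw) => x0 y0 qmax.
apply: (@growth_line (fun x => v (x, y0)) (fun x => w (x, y0)) a b x0).
- by move=> x; have := pd1P x y0 (torus_smooth Vv); rewrite Ev.
- by move=> x; have := pd1P x y0 (torus_smooth Vw); rewrite Ew.
- by move=> x; exact: qmax.
Qed.

Lemma pd2_no_growth lam v w (a b : R) : torus_space lam v -> torus_space lam w ->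
  pd2 v = (fun p => a * v p - b * w p) -> pd2 w = (fun p => b * v p + a * w p) ->
  v <> (fun=> 0) \/ w <> (fun=> 0) -> a = 0.
Proof.
move=> Vv Vw Ev Ew; apply: (no_growth Vv Vw) => x0 y0 qmax.
apply: (@growth_line (fun y => v (x0, y)) (fun y => w (x0, y)) a b y0).
- by move=> y; have := pd2P x0 y (torus_smooth Vv); rewrite Ev.
- by move=> y; have := pd2P x0 y (torus_smooth Vw); rewrite Ew.
- by move=> y; exact: qmax.
Qed.

(** Applied with D = d/dx and D = d/dy, where the hypothesis excluding a real
    part of the eigenvalue comes from the maximum of v^2 + w^2. *)
Lemma oscillating_mode lam (S : set fn) (D : fn -> fn) : subspace S -> S `<=` torus_space lam ->
  linear_on S D -> (forall u, S u -> S (D u)) ->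
  (forall v w (a b : R), S v -> S w ->
    D v = (fun p => a * v p - b * w p) -> D w = (fun p => b * v p + a * w p) ->
    v <> (fun=> 0) \/ w <> (fun=> 0) -> a = 0) ->
  (exists2 u, S u & u <> fun=> 0) ->
  exists (v : fn) (b : R), [/\ S v, v <> (fun=> 0) & D (D v) = fun p => - b ^+ 2 * v p].
Proof.
move=> sS SV lD DS noG Sn0; have [n dS] := sub_torus_has_dim sS SV.
have [v [w [a [b [Sv Sw nz Ev Ew]]]]] := complex_eigenvector sS lD DS dS Sn0.
have a0 : a = 0 := noG v w a b Sv Sw Ev Ew nz.
have Ev' : D v = fun p => 0 * v p + (- b) * w p.
  by rewrite Ev a0; apply/funext => p; rewrite mulNr.
have Ew' : D w = fun p => b * v p + 0 * w p by rewrite Ew a0.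
have DDv : D (D v) = fun p => - b ^+ 2 * v p.
  by rewrite {1}Ev' lD // Ev' Ew'; apply/funext => p; ring.
have DDw : D (D w) = fun p => - b ^+ 2 * w p.
  by rewrite {1}Ew' lD // Ev' Ew'; apply/funext => p; ring.
by case: nz => nz; [exists v, b|exists w, b].
Qed.

(** Separation of variables without a basis: a nonzero v with v_xx = - b^2 v
    exists by [oscillating_mode], and d/dy acts on the space of all such v, so
    some nonzero w has w_yy = - c^2 w as well. Then lam = b^2 + c^2, and the
    periodicity of w along a horizontal and a vertical line through a point
    where w does not vanish restricts b and c. *)
Lemma eigenvalue_form lam : (exists2 u, torus_space lam u & u <> fun=> 0) ->
  exists j k : nat, lam = (j%:R * pi) ^+ 2 + (k%:R * pi / 2) ^+ 2.
Proof.
move=> Vn0.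
have [v [b [Vv vn0 Ev]]] := oscillating_mode (torus_subspace lam) (fun u => id)
  (linear_on_sub (@torus_sub_smooth lam) (@linear_on_pd1 R)) (@torus_pd1 R lam)
  (@pd1_no_growth lam) Vn0.
pose S1 : set fn := [set u | torus_space lam u /\ pd1 (pd1 u) = fun p => - b ^+ 2 * u p].
have S1V : S1 `<=` torus_space lam by move=> u [].
have sS1 : subspace S1.
  split.
    split; first exact: (torus_subspace lam).1.
    by rewrite !pd1_0; apply/funext => p; rewrite mulr0.
  move=> r s u w [Vu Eu] [Vw Ew]; split; first exact: (torus_subspace lam).2.
  have su := torus_smooth Vu; have sw := torus_smooth Vw.
  rewrite (pd1_lin r s su sw) (pd1_lin r s (smooth_pd1 su) (smooth_pd1 sw)) Eu Ew.
  by apply/funext => p; ring.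
have S1D u : S1 u -> S1 (pd2 u).
  move=> [Vu Eu]; split; first exact: torus_pd2.
  have su := torus_smooth Vu.
  rewrite (pd_commute su) (pd_commute (smooth_pd1 su)) Eu.
  (* Padded with 0 u to have the shape of a combination of two functions. *)
  have Z : (fun p => - b ^+ 2 * u p) = (fun p => - b ^+ 2 * u p + 0 * u p).
    by apply/funext => p; rewrite mul0r addr0.
  rewrite Z (pd2_lin _ _ su su); apply/funext => p; by rewrite mul0r addr0.
have [w [c [[Vw Ew] wn0 Fw]]] := oscillating_mode sS1 S1V
  (linear_on_sub (subset_trans S1V (@torus_sub_smooth lam)) (@linear_on_pd2 R)) S1D
  (fun v w a b Sv Sw => pd2_no_growth (S1V _ Sv) (S1V _ Sw))
  (ex_intro2 _ _ v (conj Vv Ev) vn0).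
have [x0 [y0 w0]] : exists x0 y0, w (x0, y0) != 0.
  apply/not_existsP => H; apply: wn0; apply/funext => -[x y].
  by apply/eqP/negPn/negP => wxy; apply: (H x); exists y.
have sw := torus_smooth Vw; have V1 := torus_pd1 Vw; have V2 := torus_pd2 Vw.
have lamE : lam = b ^+ 2 + c ^+ 2.
  apply: (mulIf w0); apply: oppr_inj; rewrite -mulNr -(torus_lap (x0, y0) Vw) Ew Fw; ring.
have Dx (x : R) : is_derive x 1 (fun s => pd1 w (s, y0)) (- b ^+ 2 * w (x, y0)).
  by have := pd1P x y0 (torus_smooth V1); rewrite Ew.
have Dy (y : R) : is_derive y 1 (fun s => pd2 w (x0, s)) (- c ^+ 2 * w (x0, y)).
  by have := pd2P x0 y (torus_smooth V2); rewrite Fw.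
have [||j jE] := period_quantum (fun x => pd1P x y0 sw) Dx _ _ w0 (T := 1).
- by have := torus_per1 0 y0 Vw; rewrite add0r.
- by have := torus_per1 0 y0 V1; rewrite add0r.
have [||k kE] := period_quantum (fun y => pd2P x0 y sw) Dy _ _ w0 (T := 2).
- by have := torus_per2 x0 0 Vw; rewrite add0r.
- by have := torus_per2 x0 0 V2; rewrite add0r.
by exists j, k; rewrite lamE -jE mulr1 expr_div_n -kE; field.
Qed.

Definition trig (P Q c : R) : fn := fun p => P * cos (c * p.2) + Q * sin (c * p.2).

Lemma trig_derive1 P Q c (x y : R) : is_derive x 1 (fun s => trig P Q c (s, y)) 0.
Proof. exact: (is_derive_cst (trig P Q c (0, y)) x (1 : R)). Qed.

Lemma trig_derive2 P Q c (x y : R) :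
  is_derive y 1 (fun s => trig P Q c (x, s)) (trig (c * Q) (- c * P) c (x, y)).
Proof.
have := is_deriveD (is_deriveZ P (derive_cos_scale c y)) (is_deriveZ Q (derive_sin_scale c y)).
by move=> H; apply: (is_derive_eq H); rewrite /trig /GRing.scale /=; ring.
Qed.

Lemma pd1_trig P Q c : pd1 (trig P Q c) = fun=> 0.
Proof. by apply/funext => -[x y]; apply: pd1E; exact: trig_derive1. Qed.

Lemma pd2_trig P Q c : pd2 (trig P Q c) = trig (c * Q) (- c * P) c.
Proof. by apply/funext => -[x y]; apply: pd2E; exact: trig_derive2. Qed.

Lemma smooth_trig P Q c : smooth (trig P Q c).
Proof.
have ct P' Q' : continuous (trig P' Q' c).
  have cc (f : R -> R) : continuous f -> continuous (fun p : R * R => f (c * p.2)).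
    move=> cf p; apply: (@continuous_comp _ _ _ (fun p : R * R => c * p.2) f) => //.
      by apply: cvgMr; exact: cvg_snd.
    exact: cf.
  move=> p; apply: cvgD; apply: cvgMr; apply: cc; [exact: continuous_cos|exact: continuous_sin].
move=> k; elim: k P Q => [|k IH] P Q //=; split=> //; split.
- by move=> [x y]; apply: ex_derive; apply/line1; exact: trig_derive1.
- by move=> [x y]; apply: ex_derive; apply/line2; exact: trig_derive2.
- by rewrite pd1_trig; exact: (smooth_subspace R).1.
- by rewrite pd2_trig.
Qed.

Lemma trig_glide P Q c e : cos c = e -> sin c = 0 -> forall x y,
  trig P Q c (x, y + 1) = e * trig P Q c (0, y).
Proof.
by move=> cc sc x y; rewrite /trig /= mulrDr mulr1 cosD sinD cc sc; ring.
Qed.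

Lemma glide_space_trig P Q c e : cos c = e -> sin c = 0 -> glide_space e (c ^+ 2) (trig P Q c).
Proof.
move=> cc sc; have e2 : e ^+ 2 = 1.
  by rewrite -cc -(cos2Dsin2 c) sc expr0n addr0.
split.
  apply: torus_intro; first exact: smooth_trig.
  - by [].
  - move=> x y; rewrite (_ : y + 2 = y + 1 + 1); last by ring.
    rewrite !(trig_glide _ _ cc sc) mulrA -expr2 e2 mul1r //.
  - move=> p; rewrite pd1_trig pd1_0 !pd2_trig /trig; ring.
by apply/funext => -[x y]; rewrite /glide /= (trig_glide _ _ cc sc).
Qed.

(** The dimension of the space of eigenfunctions u with u o g = e u which
    depend on y alone: cos (c y) and sin (c y) with c^2 = lam have this symmetry
    when cos c = e, and they collapse to the constants for c = 0. *)
Definition zonal_dim e lam : nat :=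
  if cos (Num.sqrt lam) == e then (if lam == 0 then 1%N else 2%N) else 0%N.

Lemma pd1_eq0_const u x y : smooth u -> pd1 u = (fun=> 0) -> u (x, y) = u (0, y).
Proof.
move=> su E; apply: (@constant_of_derive0 R (fun s => u (s, y))) => s.
by have := pd1P s y su; rewrite E.
Qed.

(** If u_x does not depend on x, then u is affine in x; being periodic, it is
    constant in x. *)
Lemma pd1_ker_im lam u : torus_space lam u -> pd1 (pd1 u) = (fun=> 0) -> pd1 u = fun=> 0.
Proof.
move=> Vu E; have su := torus_smooth Vu; apply/funext => -[x y].
have [c [_ _ Ec]] := mean_value (ltr01 : (0 : R) < 1) (fun s => pd1P s y su).
have := torus_per1 0 y Vu; rewrite add0r => per; move: Ec; rewrite per subrr subr0 mulr1.
rewrite (pd1_eq0_const c y (smooth_pd1 su) E).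
by rewrite (pd1_eq0_const x y (smooth_pd1 su) E) => <-.
Qed.

(** The profile u (0, _) solves the oscillator equation and satisfies
    h (y + 1) = e h (y); for c <> 0 such a solution vanishes unless cos c = e,
    and then every solution qualifies. For c = 0 the profile is constant. *)
Lemma ker_dim e lam : 0 <= lam -> e ^+ 2 = 1 ->
  has_dim [set u | glide_space e lam u /\ pd1 u = fun=> 0] (zonal_dim e lam).
Proof.
move=> lam0 e2; pose c := Num.sqrt lam.
have c2 : c ^+ 2 = lam by rewrite sqr_sqrtr.
(* As e = 1 or e = - 1, the condition cos c = e also fixes the sine. *)
have c_e_sin : cos c = e -> sin c = 0.
  move=> ce; apply: cos1sin0; rewrite ce; move/eqP: e2; rewrite sqrf_eq1.
  by move=> /orP[]/eqP->; rewrite ?normrN1 ?normr1.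
(* All conditions on u pass to its profile on the line x = 0. *)
have prof u : glide_space e lam u -> pd1 u = (fun=> 0) ->
    [/\ forall x y, u (x, y) = u (0, y),
        forall y : R, is_derive y 1 (fun s => u (0, s)) (pd2 u (0, y)),
        forall y : R, is_derive y 1 (fun s => pd2 u (0, s)) (- c ^+ 2 * u (0, y)),
        forall y, u (0, y + 1) = e * u (0, y) & forall y, pd2 u (0, y + 1) = e * pd2 u (0, y)].
  move=> [Vu gu] E; have su := torus_smooth Vu.
  have E2 : pd1 (pd2 u) = fun=> 0 by rewrite (pd_commute su) E pd2_0.
  split.
  - by move=> x y; exact: pd1_eq0_const.
  - by move=> y; exact: pd2P.
  - move=> y; have := pd2P 0 y (smooth_pd2 su).
    by have := torus_lap (0, y) Vu; rewrite E pd1_0 add0r c2 => ->.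
  - move=> y; rewrite -(pd1_eq0_const (1 - 0) (y + 1) su E).
    by have := congr1 (fun w => w (0, y)) gu.
  - move=> y; rewrite -(pd1_eq0_const (1 - 0) (y + 1) (smooth_pd2 su) E2).
    have := congr1 (fun w => w (0, y)) (pd2_glide su); rewrite gu.
    have Z : (fun p => e * u p) = (fun p => e * u p + 0 * u p).
      by apply/funext => p; rewrite mul0r addr0.
    by rewrite Z (pd2_lin _ _ su su) mul0r addr0 => H; exact: esym H.
have zero_dim : (forall u, glide_space e lam u -> pd1 u = (fun=> 0) -> forall y, u (0, y) = 0) ->
    has_dim [set u | glide_space e lam u /\ pd1 u = fun=> 0] 0.
  move=> H; exists (fun _ _ => 0); split; [by case|by move=> d _ []|].
  move=> u [Su Eu]; exists (fun=> 0); apply/funext => -[x y].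
  have [-> _ _ _ _] := prof u Su Eu.
  by rewrite /comb big_ord0; exact: H.
rewrite /zonal_dim -/c; have [lamE|lamn0] := eqVneq lam 0.
  have c0 : c = 0 by rewrite /c lamE sqrtr0.
  have const u : glide_space e lam u -> pd1 u = (fun=> 0) -> forall y, u (0, y) = u (0, 0).
    move=> Su Eu; have [ux d1 d2 _ _] := prof u Su Eu; have [Vu _] := Su.
    have K : forall r t, pd2 u (0, r) = pd2 u (0, t).
      apply: (@constant_of_derive0 R (fun s => pd2 u (0, s))) => r.
      by have := d2 r; rewrite c0 expr0n oppr0 mul0r.
    have [z [_ _ Ez]] := mean_value (ltr0n R 2 : (0 : R) < 2) d1.
    have := torus_per2 0 0 Vu; rewrite add0r => per; move: Ez; rewrite per subrr subr0 => /esym/eqP.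
    rewrite mulf_eq0 pnatr_eq0 orbF => /eqP z0 y.
    apply: (@constant_of_derive0 R (fun s => u (0, s))) => s.
    apply: (is_derive_eq (d1 s)).
    exact: etrans (K s z) z0.
  rewrite c0 cos0; have [e1|en1] := eqVneq 1 e.
    exists (fun _ => trig 1 0 c); split.
    - move=> _; split; last exact: pd1_trig.
      by rewrite -c2; apply: glide_space_trig; [rewrite c0 cos0|rewrite c0 sin0].
    - move=> d d0 i; have := d0 (0, 0).
      by rewrite big_ord1 /trig mulr0 cos0 mul0r addr0 !mulr1 (ord1 i).
    - move=> u [Su Eu]; exists (fun _ => u (0, 0)); apply/funext => -[x y].
      have [-> _ _ _ _] := prof u Su Eu; rewrite const //.
      by rewrite /comb big_ord1 /trig c0 !mul0r cos0 addr0 !mulr1.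
  apply: zero_dim => u Su Eu y; rewrite const //.
  have [_ _ _ ge _] := prof u Su Eu; have := ge 0; rewrite const // => /eqP.
  rewrite -subr_eq0 -{1}[u _]mul1r -mulrBl mulf_eq0 subr_eq0 (negbTE en1) /= => /eqP //.
have c0 : c != 0 by rewrite /c sqrtr_eq0 -ltNge lt_def lamn0.
have [ce|cne] := eqVneq (cos c) e.
  have sc := c_e_sin ce.
  pose f (i : 'I_2) := if val i == 0%N then trig 1 0 c else trig 0 1 c.
  have combE d (y : R) x : \sum_(i < 2) d i * f i (x, y) =
      d ord0 * cos (c * y) + d (lift ord0 ord0) * sin (c * y).
    by rewrite big_ord_recl big_ord1 /f /= /trig; ring.
  exists f; split.
  - move=> i; rewrite /f; case: ifP => _; (split; last exact: pd1_trig);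
      by rewrite -c2; apply: glide_space_trig.
  - move=> d d0.
    have A0 : d ord0 = 0.
      by have := d0 (0, 0); rewrite combE mulr0 cos0 sin0 mulr1 mulr0 addr0.
    (* At y = pi / (2 c) the cosine vanishes and the sine is 1. *)
    have A1 : d (lift ord0 ord0) = 0.
      have := d0 (0, pi / 2 / c); rewrite combE (mulrC c) divfK // cos_pihalf sin_pihalf.
      by rewrite mulr0 add0r mulr1.
    by move=> i; case: (unliftP ord0 i) => [j ->|-> //]; rewrite (ord1 j).
  - move=> u [Su Eu]; have [ux d1 d2 _ _] := prof u Su Eu.
    exists (fun i => if val i == 0%N then u (0, 0) else pd2 u (0, 0) / c).
    apply/funext => -[x y]; rewrite /comb combE /= ux.
    by have [] := oscillator c0 d1 d2 y.
apply: zero_dim => u Su Eu; have [ux d1 d2 g1 g2] := prof u Su Eu.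
(* The rotation of angle c has the eigenvalue e only if cos c = e. *)
have h1 := g1 0; have h2 := g2 0; rewrite add0r in h1; rewrite add0r in h2.
have [//|[]] := oscillator_period c0 d1 d2 h1 h2.
by rewrite mulr1 => ce; rewrite ce eqxx in cne.
Qed.

Lemma has_dim_uniq (A : set fn) m n : has_dim A m -> has_dim A n -> m = n.
Proof.
move=> /has_dim_lin_dim E /has_dim_lin_dim; rewrite E => -[/eqP].
by rewrite eqr_nat => /eqP.
Qed.

Lemma eigenspace_dims lam : 0 <= lam -> exists m n : nat,
  [/\ lin_dim (glide_space 1 lam) = m%:R%:E, lin_dim (torus_space lam) = (m + n)%:R%:E
    & (m + zonal_dim (- 1) lam = n + zonal_dim 1 lam)%N].
Proof.
move=> lam0.
have SV e : glide_space e lam `<=` torus_space lam by move=> u [].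
have [m dm] := sub_torus_has_dim (glide_space_subspace 1 lam) (SV 1).
have [n dn] := sub_torus_has_dim (glide_space_subspace (- 1) lam) (SV (- 1)).
exists m, n; split; first exact: has_dim_lin_dim.
  by apply: has_dim_lin_dim; exact: torus_direct_sum.
have Sm u : glide_space (- 1) lam u -> glide_space 1 lam (pd1 u).
  by move=> /glide_space_pd1; rewrite opprK.
have [k [l [dk dl E]]] := index_zero (torus_subspace lam)
  (linear_on_sub (@torus_sub_smooth lam) (@linear_on_pd1 R)) (SV 1) (SV (- 1))
  (glide_space_subspace 1 lam) (glide_space_subspace (- 1) lam)
  (@glide_space_pd1 R 1 lam) Sm (@pd1_ker_im lam) dm dn.
rewrite (has_dim_uniq dk (ker_dim lam0 (expr1n _ _))) in E.
have m1 : (- 1 : R) ^+ 2 = 1 by rewrite sqrrN expr1n.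
by rewrite (has_dim_uniq dl (ker_dim lam0 m1)) in E.
Qed.

End Spectrum.

(** * Summation over the spectrum *)

Section Counting.
Set Implicit Arguments.
Unset Strict Implicit.
Local Open Scope classical_set_scope.
Local Open Scope ring_scope.
Variable R : realType.
Implicit Types (lam t e : R) (s : seq R).

Lemma lin_dim_ge0 (A : set (R * R -> R)) : (0 <= lin_dim A)%E.
Proof.
apply: ereal_sup_ubound; exists 0%N => //; exists (fun _ _ => 0); split; first by case.
by move=> c _ [].
Qed.

(** Values of s that are not eigenvalues may be included: their eigenspace is
    0 and contributes nothing. *)
Lemma counting_finite (X : set (R * R -> R)) t s : uniq s ->
  (forall lam, is_eigenvalue X lam -> lam <= t -> lam \in s) ->
  (forall lam, lam \in s -> lam <= t) ->
  Defs.counting X t = (\sum_(lam <- s) lin_dim (lap_eigenspace X lam))%E.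
Proof.
move=> us Xs st.
rewrite /Defs.counting (_ : [set lam | _] = [set` s] `&` [set lam | is_eigenvalue X lam]); last first.
  apply/seteqP; split=> lam /=; first by move=> [ev le]; split=> //; exact: Xs.
  by move=> [ls ev]; split=> //; exact: st.
rewrite esum_mkcondr.
rewrite (eq_esum (b := fun lam => lin_dim (lap_eigenspace X lam))); last first.
  move=> lam _; case: ifPn => //; rewrite notin_setE /= => nev.
  apply/esym; rewrite (_ : 0%E = (0%:R)%:E) //; apply: has_dim_lin_dim.
  exists (fun _ _ => 0); split; [by case|by move=> c _ []|].
  move=> u Xu; exists (fun=> 0); apply/funext => p; rewrite /comb big_ord0.
  by apply: contrapT => up; apply: nev; exists u; split=> //; exists p.
rewrite esum_fset; [by rewrite -fsbig_seq|exact: finite_seq|].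
by move=> lam _; exact: lin_dim_ge0.
Qed.

(** All numbers of the form given by [eigenvalue_form] that are at most t. The
    bound N suffices for both indices because pi / 2 >= 1. *)
Definition spectrum_le t : seq R :=
  let N := (Num.truncn t).+1 in
  undup [seq lam <- [seq (jk.1%:R * pi) ^+ 2 + (jk.2%:R * pi / 2) ^+ 2
                    | jk <- [seq (j, k) | j <- iota 0 N, k <- iota 0 N]] | lam <= t].

Lemma mem_spectrum_le t (j k : nat) : 0 <= t ->
  (j%:R * pi) ^+ 2 + (k%:R * pi / 2) ^+ 2 <= t ->
  (j%:R * pi) ^+ 2 + (k%:R * pi / 2) ^+ 2 \in spectrum_le t.
Proof.
move=> t0 le; rewrite mem_undup mem_filter le andTb.
apply/mapP; exists (j, k) => //.
have small (n : nat) : n%:R ^+ 2 <= t -> (n < (Num.truncn t).+1)%N.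
  move=> n2; rewrite -(ltr_nat R); apply: le_lt_trans (truncnS_gt t); apply: le_trans n2.
  by rewrite -natrX ler_nat; case: n => // n; rewrite expnS leq_pmulr.
have p2 : 2 <= pi :> R := pi_ge2 R.
have pi1 : 1 <= pi :> R by lra.
have pi2 : 1 <= pi / 2 :> R by lra.
have grow (n : nat) (r : R) : 1 <= r -> n%:R ^+ 2 <= (n%:R * r) ^+ 2.
  move=> r1; rewrite exprMn ler_peMr ?sqr_ge0 //; exact: exprn_ege1.
apply/allpairsP; exists (j, k); split=> //; rewrite mem_iota add0n; apply: small.
  by apply: le_trans (grow _ _ pi1) _; apply: le_trans le; rewrite lerDl sqr_ge0.
apply: le_trans (grow _ _ pi2) _; apply: le_trans le.
by rewrite mulrA lerDr sqr_ge0.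
Qed.

Lemma spectrum_le_ge0 t lam : lam \in spectrum_le t -> 0 <= lam.
Proof.
by rewrite mem_undup mem_filter => /andP[_ /mapP[jk _ ->]]; rewrite addr_ge0 ?sqr_ge0.
Qed.

Lemma spectrum_le_le t lam : lam \in spectrum_le t -> lam <= t.
Proof. by rewrite mem_undup mem_filter => /andP[]. Qed.

Lemma eigenvalue_in_spectrum (X : set (R * R -> R)) t lam : 0 <= t ->
  lap_eigenspace X lam `<=` torus_space lam -> is_eigenvalue X lam -> lam <= t ->
  lam \in spectrum_le t.
Proof.
move=> t0 XV [u [Xu [p up]]].
have [|j [k ->]] := @eigenvalue_form R lam; last exact: mem_spectrum_le.
by exists u; [exact: XV|move=> u0; apply: up; rewrite u0].
Qed.

Lemma cos_natpi (k : nat) : cos (k%:R * pi) = (-1) ^+ k :> R.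
Proof.
by have := alternatingn (@cosDpi R) k 0; rewrite add0r cos0 mulr1 mulr_natl.
Qed.

Lemma zonal_dim_natpi e (k : nat) : zonal_dim e ((k%:R * pi) ^+ 2) =
  if (-1) ^+ k == e then (if k == 0%N then 1%N else 2%N) else 0%N.
Proof.
rewrite /zonal_dim sqrtr_sqr ger0_norm ?mulr_ge0 ?pi_ge0 // cos_natpi.
by rewrite sqrf_eq0 mulf_eq0 (gt_eqF (pi_gt0 R)) orbF pnatr_eq0.
Qed.

(** Only the lam = (k pi)^2 contribute, as cos (sqrt lam) = e with e = 1 or
    e = - 1 makes sqrt lam a zero of the sine. *)
Lemma sum_zonal_dim t e : 0 <= t -> e ^+ 2 = 1 ->
  (\sum_(lam <- spectrum_le t) zonal_dim e lam =
   \sum_(0 <= k < (Num.truncn (Num.sqrt t / pi)).+1) zonal_dim e ((k%:R * pi) ^+ 2))%N.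
Proof.
move=> t0 e2; set M := Num.truncn _.
have p0 : 0 < pi :> R := pi_gt0 R.
have leM (k : nat) : ((k%:R * pi) ^+ 2 <= t) = (k <= M)%N.
  have st0 : 0 <= Num.sqrt t by [].
  have kp0 : 0 <= k%:R * pi :> R by apply: mulr_ge0; [exact: ler0n|exact: ltW].
  rewrite -{1}(sqr_sqrtr t0) ler_pXn2r // -ler_pdivlMr //.
  by rewrite truncn_ge_nat // divr_ge0 // ltW.
pose G := [seq (k%:R * pi) ^+ 2 | k <- iota 0 M.+1] : seq R.
have uG : uniq G.
  rewrite map_inj_uniq ?iota_uniq // => a b /eqP.
  have kp0 (k : nat) : 0 <= k%:R * pi :> R by apply: mulr_ge0; [exact: ler0n|exact: ltW].
  rewrite eqrXn2 // => /eqP /(mulIf (lt0r_neq0 p0)) /eqP.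
  by rewrite eqr_nat => /eqP.
rewrite (bigID (mem G)) /= [X in (_ + X)%N]big1_seq ?addn0; last first.
  move=> lam /andP[nG ls]; rewrite /zonal_dim; case: ifP => // /eqP ce; case/negP: nG.
  have lam0 := spectrum_le_ge0 ls.
  have /sin_eq0_natmul[k] : sin (Num.sqrt lam) = 0.
    by apply/eqP; rewrite -sqrf_eq0 sin2cos2 ce e2 subrr.
  rewrite sqr_sqrtr // => lamE; apply/mapP; exists k => //.
  by rewrite mem_iota /= add0n ltnS -leM -lamE; exact: spectrum_le_le ls.
rewrite -big_filter (perm_big G); first by rewrite big_map /index_iota subn0.
apply: uniq_perm; rewrite ?filter_uniq ?undup_uniq // => lam.
rewrite mem_filter; case lG: (lam \in G) => //=.
move: lG => /mapP[k]; rewrite mem_iota /= add0n ltnS => kM ->.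
have := @mem_spectrum_le t k 0 t0; rewrite !mul0r expr0n addr0; apply.
by rewrite leM.
Qed.

Lemma sum_zonal_dim_natpi (M : nat) :
  (\sum_(0 <= k < M.+1) zonal_dim (1 : R) ((k%:R * pi) ^+ 2) = 1 + (M./2).*2 /\
   \sum_(0 <= k < M.+1) zonal_dim (- 1 : R) ((k%:R * pi) ^+ 2) = (uphalf M).*2)%N.
Proof.
have m1 : ((1 : R) == -1) = false by rewrite eq_sym; apply/eqP; lra.
have m2 : ((-1 : R) == 1) = false by rewrite eq_sym m1.
elim: M => [|M [IH1 IH2]].
  by rewrite !big_nat1 !zonal_dim_natpi expr0 m1 !eqxx.
rewrite !(@big_nat_recr _ _ _ M.+1) //= IH1 IH2 !zonal_dim_natpi -signr_odd /=.
rewrite uphalf_half; case: (odd M) => /=; rewrite ?expr0 ?expr1 ?eqxx ?m1 ?m2; lia.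
Qed.

Lemma zonal_dim_index t : 0 <= t ->
  (\sum_(lam <- spectrum_le t) zonal_dim 1 lam = (\sum_(lam <- spectrum_le t) zonal_dim (- 1) lam).+1 \/
   (\sum_(lam <- spectrum_le t) zonal_dim 1 lam).+1 = \sum_(lam <- spectrum_le t) zonal_dim (- 1) lam)%N.
Proof.
move=> t0; have m1 : (- 1 : R) ^+ 2 = 1 by rewrite sqrrN expr1n.
rewrite !sum_zonal_dim ?expr1n //; move: (Num.truncn _) => M.
have [-> ->] := sum_zonal_dim_natpi M; rewrite uphalf_half.
by case: (odd M); [right|left]; lia.
Qed.

Lemma counting_values t : 0 <= t -> exists m n : nat,
  [/\ N_KB t = m%:R%:E, N_T12 t = (m + n)%:R%:E & m = n.+1 \/ n = m.+1].
Proof.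
move=> t0.
have /choice[mn mnE] (lam : R) : exists mn : nat * nat, 0 <= lam ->
    [/\ lin_dim (glide_space 1 lam) = mn.1%:R%:E, lin_dim (torus_space lam) = (mn.1 + mn.2)%:R%:E
    & (mn.1 + zonal_dim (- 1) lam = mn.2 + zonal_dim 1 lam)%N].
  have [lam0|lam0] := leP 0 lam; last by exists (0%N, 0%N).
  by have [m [n H]] := eigenspace_dims lam0; exists (m, n).
pose s := spectrum_le t; have us : uniq s := undup_uniq _.
have sum_nat (f : R -> nat) :
    (\sum_(lam <- s) (f lam)%:R%:E = ((\sum_(lam <- s) f lam)%N%:R : R)%:E)%E.
  by rewrite sumEFin natr_sum.
exists (\sum_(lam <- s) (mn lam).1)%N, (\sum_(lam <- s) (mn lam).2)%N; split.
- rewrite /N_KB (@counting_finite _ t s us) -?sum_nat; first last.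
  + by move=> lam; exact: spectrum_le_le.
  + move=> lam; apply: eigenvalue_in_spectrum => //.
    by rewrite KB_eigenspace => u [].
  rewrite big_seq [RHS]big_seq; apply: eq_bigr => lam ls.
  by rewrite KB_eigenspace; have [] := mnE lam (spectrum_le_ge0 ls).
- rewrite /N_T12 (@counting_finite _ t s us) -?big_split -?sum_nat /=; first last.
  + by move=> lam; exact: spectrum_le_le.
  + by move=> lam; apply: eigenvalue_in_spectrum.
  rewrite big_seq [RHS]big_seq; apply: eq_bigr => lam ls.
  by have [] := mnE lam (spectrum_le_ge0 ls).
have : (\sum_(lam <- s) (mn lam).1 + \sum_(lam <- s) zonal_dim (- 1) lam =
        \sum_(lam <- s) (mn lam).2 + \sum_(lam <- s) zonal_dim 1 lam)%N.
  rewrite -!big_split /= big_seq [RHS]big_seq; apply: eq_bigr => lam ls.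
  by have [] := mnE lam (spectrum_le_ge0 ls).
by have := zonal_dim_index t0; rewrite -/s; lia.
Qed.

End Counting.

Local Open Scope ereal_scope.

(* In \bar R one has +oo - +oo = -oo, so each equality below forces both
   counting functions to be finite. *)
Theorem theorem5 (R : realType) (t : R) (ht : (0 <= t)%R) :
  N_KB t - (2^-1)%:E * N_T12 t = (2^-1)%:E \/
  N_KB t - (2^-1)%:E * N_T12 t = - (2^-1)%:E.
Proof.
have [m [n [-> -> mn]]] := counting_values ht.
rewrite -EFinM -EFinB -EFinN natrD.
by case: mn => ->; [left|right]; congr EFin; rewrite -natr1; field.
Qed.
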